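(* Let $\mathcal L$ be a semilattice and $(\mathfrak A,(A_\ell)_{\ell\in\mathcal L})$ a commutative $\mathcal L$-graded $C^*$-algebra. If $\mathcal L$ is a good semilattice, then $$\mathrm{Sp}(\mathfrak A)=\bigcup_{i\in\mathcal L}\psi_i(\mathrm{Sp}(A_i)).$$
   Context: A semilattice is a partially ordered set $\mathcal L$ in which any two elements $k,\ell$ have a greatest lower bound $k\wedge\ell$. It is called good (''bon semi-treillis'') if every nonempty totally ordered subset of $\mathcal L$ is well ordered. A $C^*$-algebra $\mathfrak A$ is $\mathcal L$-graded with components $(A_i)_{i\in\mathcal L}$, written $(\mathfrak A,(A_i)_{i\in\mathcal L})$, if $(A_i)_{i\in\mathcal L}$ is a family of sub-$C^*$-algebras of $\mathfrak A$ which is linearly independent (if $S_i\in A_i$, only finitely many $S_i$ are nonzero and $\sum_i S_i=0$, then all $S_i=0$), total (the linear span of $\bigcup_i A_i$ is dense in $\mathfrak A$), and satisfies $A_iA_j\subset A_{i\wedge j}$ for all $i,j\in\mathcal L$. $\mathrm{Sp}(A)$ denotes the set of characters (nonzero continuous homomorphisms to $\mathbb C$) of a commutative $C^*$-algebra $A$, with the topology of pointwise convergence. For $i\in\mathcal L$ let $\mathcal L_i=\{j\in\mathcal L:i\le j\}$ and let $\overline{\mathfrak A_{\mathcal L_i}}$ be the closure of $\bigoplus_{j\in\mathcal L_i}A_j$. There is a unique homomorphism $p_i:\mathfrak A\to\overline{\mathfrak A_{\mathcal L_i}}$ which is the identity on $A_j$ for $i\le j$ and zero on $A_j$ for $i\not\le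 j$; $A_i$ is a closed ideal of $\overline{\mathfrak A_{\mathcal L_i}}$, giving $\varphi_i:\overline{\mathfrak A_{\mathcal L_i}}\to M(A_i)$, $\varphi_i(a)x=ax$; put $\pi_i=\varphi_i\circ p_i:\mathfrak A\to M(A_i)$, where $M(A_i)$ is the multiplier algebra. Each character $\chi_i$ of $A_i$ extends uniquely to a character $\widetilde{\chi_i}$ of $M(A_i)$, and $\psi_i:\mathrm{Sp}(A_i)\to\mathrm{Sp}(\mathfrak A)$ is the map $\psi_i(\chi_i)=\widetilde{\chi_i}\circ\pi_i$. *)

(* Defs.v *)
From HB Require Import structures.
From mathcomp Require Import all_boot all_order all_algebra.
From mathcomp Require Import all_classical all_reals.
From mathcomp Require Import topology normedtype.
From mathcomp Require Import complex.

Set Implicit Arguments.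
Unset Strict Implicit.
Unset Printing Implicit Defensive.

Import Order.TTheory GRing.Theory Num.Theory.
Import numFieldNormedType.Exports.

Local Open Scope classical_set_scope.
Local Open Scope ring_scope.
Local Open Scope complex_scope.

Reserved Notation "x ** y" (at level 40, left associativity).

(* MathComp's algebra types are unital, whereas the algebras here need not have
   a unit: the product is therefore a separate operation [x ** y]. *)
HB.mixin Record NormedModule_isNormedAlgebra (K : numFieldType) A
    & NormedModule K A := {
  amul : A -> A -> A;
  amulA : associative amul;
  amulDl : left_distributive amul +%R;
  amulDr : right_distributive amul +%R;
  scale_amull : forall (k : K) (x y : A), amul (k *: x) y = k *: amul x y;
  scale_amulr : forall (k : K) (x y : A), amul x (k *: y) = k *: amul x y;
  ler_norm_amul : forall x y : A, `|amul x y| <= `|x| * `|y|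
}.

#[short(type="normedAlgType")]
HB.structure Definition NormedAlgebra (K : numFieldType) :=
  {A of NormedModule K A & NormedModule_isNormedAlgebra K A}.

Notation "x ** y" := (amul x y) : ring_scope.

HB.mixin Record NormedAlgebra_isCStar (R : realType) A
    & NormedAlgebra R[i] A & Complete A := {
  star : A -> A;
  starK : involutive star;
  starD : {morph star : x y / x + y};
  starZ : forall (k : R[i]) (x : A), star (k *: x) = k^* *: star x;
  starM : forall x y : A, star (amul x y) = amul (star y) (star x);
  norm_starM : forall x : A, `|amul (star x) x| = `|x| ^+ 2
}.

#[short(type="cstarType")]
HB.structure Definition CStar (R : realType) :=
  {A of NormedAlgebra R[i] A & Complete A & NormedAlgebra_isCStar R A}.

Section hom.
Context {R : realType}.

(* Continuity of *-homomorphisms between C*-algebras is automatic. *)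
Record star_hom (A B : cstarType R) (f : A -> B) : Prop := StarHom {
  star_hom_linear : linear f;
  star_homM : {morph f : x y / x ** y};
  star_hom_star : {morph f : x / star x};
  star_hom_continuous : continuous f
}.

Record character (A : normedAlgType R[i]) (f : A -> R[i]) : Prop := Character {
  character_linear : scalar f;
  characterM : {morph f : x y / x ** y >-> x * y};
  character_continuous : continuous (f : A -> R[i]^o);
  character_neq0 : exists x, f x != 0
}.

Definition Sp (A : normedAlgType R[i]) : set (A -> R[i]) := [set f | character f].

End hom.
Arguments Sp {R} A.

Record subCStar (R : realType) (A : cstarType R) := SubCStar {
  subCStar_set : set A;
  subCStar_closed : closed subCStar_set;
  subCStar0 : subCStar_set 0;
  subCStarD : forall x y, subCStar_set x -> subCStar_set y -> subCStar_set (x + y);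
  subCStarZ : forall (k : R[i]) x, subCStar_set x -> subCStar_set (k *: x);
  subCStarM : forall x y, subCStar_set x -> subCStar_set y -> subCStar_set (x ** y);
  subCStar_star : forall x, subCStar_set x -> subCStar_set (star x)
}.

Section subCStar_pred.
Context {R : realType} {A : cstarType R} (S : subCStar A).

Definition subCStar_pred : {pred A} := fun x => `[< subCStar_set S x >].

Lemma subCStar_submod : GRing.subsemimod_closed subCStar_pred.
Proof.
split; last by move=> k x /asboolP Sx; apply/asboolP/subCStarZ.
split; first by apply/asboolP/subCStar0.
by move=> x y /asboolP Sx /asboolP Sy; apply/asboolP/subCStarD.
Qed.

Lemma subCStar_opp : oppr_closed subCStar_pred.
Proof.
by move=> x /asboolP Sx; apply/asboolP; rewrite -scaleN1r; exact: subCStarZ.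
Qed.

HB.instance Definition _ := GRing.isSubmodClosed.Build R[i] A subCStar_pred
  subCStar_submod.
HB.instance Definition _ := GRing.isOppClosed.Build A subCStar_pred
  subCStar_opp.

(* A sub-C*-algebra, seen as a C*-algebra in its own right. *)
Record subCStar_type := SubCStarElt {
  cval : A; cvalP : cval \in subCStar_pred }.

HB.instance Definition _ := [isSub for cval].
HB.instance Definition _ := [Choice of subCStar_type by <:].
HB.instance Definition _ := [SubChoice_isSubZmodule of subCStar_type by <:].
HB.instance Definition _ := [SubZmodule_isSubLmodule of subCStar_type by <:].


Lemma cval_set (x : subCStar_type) : subCStar_set S (cval x).
Proof. exact/asboolP/(cvalP x). Qed.

Definition subCStar_norm (x : subCStar_type) : R[i] := `|cval x|.

Lemma subCStar_ler_normD x y :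
  subCStar_norm (x + y) <= subCStar_norm x + subCStar_norm y.
Proof. exact: ler_normD. Qed.

Lemma subCStar_normrZ (k : R[i]) x :
  subCStar_norm (k *: x) = `|k| * subCStar_norm x.
Proof. exact: normrZ. Qed.

Lemma subCStar_normr0_eq0 x : subCStar_norm x = 0 -> x = 0.
Proof. by move/normr0_eq0 => x0; exact: val_inj. Qed.

HB.instance Definition _ := Lmodule_isNormed.Build R[i] subCStar_type
  subCStar_ler_normD subCStar_normrZ subCStar_normr0_eq0.

Lemma subCStar_complete (F : set_system subCStar_type) :
  ProperFilter F -> cauchy F -> cvg F.
Proof.
move=> FF /cauchyP cF.
have cG : cauchy (cval @ F).
  apply/cauchyP => e /cF[x Fx]; exists (cval x).
  by apply: (@filterS _ F _ (ball x e)) => // y; rewrite -!ball_normE.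
have Gl : cval @ F --> lim (cval @ F) by exact: cauchy_cvg cG.
move: (lim _) Gl => l Gl.
have Sl : subCStar_set S l.
  have SF : \forall x \near F, subCStar_set S (cval x).
    by apply: nearW; exact: cval_set.
  exact: (closed_cvg _ (@subCStar_closed _ _ S) SF l Gl).
apply: (@cvgP _ _ (SubCStarElt (asboolT Sl))).
apply/cvgrPdist_lt => e e0.
by have /cvgrPdist_lt/(_ e e0) := Gl.
Qed.

HB.instance Definition _ := Uniform_isComplete.Build subCStar_type
  subCStar_complete.

Definition subCStar_mul (x y : subCStar_type) : subCStar_type :=
  SubCStarElt (asboolT (subCStarM (cval_set x) (cval_set y))).

Lemma subCStar_mulA : associative subCStar_mul.
Proof. by move=> x y z; apply: val_inj; exact: amulA. Qed.

Lemma subCStar_mulDl : left_distributive subCStar_mul +%R.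
Proof. by move=> x y z; apply: val_inj; exact: amulDl. Qed.

Lemma subCStar_mulDr : right_distributive subCStar_mul +%R.
Proof. by move=> x y z; apply: val_inj; exact: amulDr. Qed.

Lemma subCStar_scale_mull (k : R[i]) x y :
  subCStar_mul (k *: x) y = k *: subCStar_mul x y.
Proof. by apply: val_inj; exact: scale_amull. Qed.

Lemma subCStar_scale_mulr (k : R[i]) x y :
  subCStar_mul x (k *: y) = k *: subCStar_mul x y.
Proof. by apply: val_inj; exact: scale_amulr. Qed.

Lemma subCStar_ler_norm_mul x y : `|subCStar_mul x y| <= `|x| * `|y|.
Proof. exact: ler_norm_amul. Qed.

HB.instance Definition _ := NormedModule_isNormedAlgebra.Build R[i]
  subCStar_type subCStar_mulA subCStar_mulDl subCStar_mulDr
  subCStar_scale_mull subCStar_scale_mulr subCStar_ler_norm_mul.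

Definition subCStar_starop (x : subCStar_type) : subCStar_type :=
  SubCStarElt (asboolT (subCStar_star (cval_set x))).

Lemma subCStar_starK : involutive subCStar_starop.
Proof. by move=> x; apply: val_inj; exact: starK. Qed.

Lemma subCStar_starD : {morph subCStar_starop : x y / x + y}.
Proof. by move=> x y; apply: val_inj; exact: starD. Qed.

Lemma subCStar_starZ (k : R[i]) x :
  subCStar_starop (k *: x) = k^* *: subCStar_starop x.
Proof. by apply: val_inj; exact: starZ. Qed.

Lemma subCStar_starM x y :
  subCStar_starop (x ** y) = subCStar_starop y ** subCStar_starop x.
Proof. by apply: val_inj; exact: starM. Qed.

Lemma subCStar_norm_starM x : `|subCStar_starop x ** x| = `|x| ^+ 2.
Proof. exact: norm_starM. Qed.

HB.instance Definition _ := NormedAlgebra_isCStar.Build R subCStar_type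
  subCStar_starK subCStar_starD subCStar_starZ subCStar_starM
  subCStar_norm_starM.

End subCStar_pred.

Coercion subCStar_type : subCStar >-> Sortclass.

Section opnorm.
Context {R : realType} {A : normedAlgType R[i]}.
Implicit Types (f : A -> A).

Definition bounded_map f := exists k : R, forall x, `|f x| <= k%:C * `|x|.

(* Norms on a [normedModType R[i]] are [R[i]]-valued; [Re] brings them back to
   [R], where suprema make sense. *)
Definition opnorm f : R :=
  sup [set complex.Re `|f x| | x in [set x | `|x| <= 1]].

Lemma Re_normE (x : A) : (complex.Re `|x|)%:C = `|x|.
Proof. by rewrite RRe_real// normr_real. Qed.

Lemma RtoCM (a b : R) : (a * b)%:C = a%:C * b%:C.
Proof. exact: rmorphM. Qed.

Lemma opnorm_ubound f k : (forall x, `|f x| <= k%:C * `|x|) -> 0 <= k ->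
  ubound [set complex.Re `|f x| | x in [set x | `|x| <= 1]] k.
Proof.
move=> fk k0 _ [x /= x1 <-]; rewrite -lecR Re_normE (le_trans (fk x))//.
by rewrite ler_piMr// lecR.
Qed.

Lemma opnorm_nonempty f :
  [set complex.Re `|f x| | x in [set x | `|x| <= 1]] !=set0.
Proof. by exists (complex.Re `|f 0|), 0 => //=; rewrite normr0. Qed.

Lemma opnorm_le f k : (forall x, `|f x| <= k%:C * `|x|) -> 0 <= k ->
  opnorm f <= k.
Proof.
by move=> fk k0; apply: ge_sup; [exact: opnorm_nonempty|exact: opnorm_ubound].
Qed.

Lemma bounded_map_ge0 f : bounded_map f ->
  exists2 k : R, 0 <= k & forall x, `|f x| <= k%:C * `|x|.
Proof.
move=> [k fk]; exists (Num.max 0 k); first by rewrite le_max lexx.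
by move=> x; rewrite (le_trans (fk x))// ler_wpM2r// lecR le_max lexx orbT.
Qed.

Lemma opnorm_has_sup f : bounded_map f ->
  has_sup [set complex.Re `|f x| | x in [set x | `|x| <= 1]].
Proof.
move=> /bounded_map_ge0[k k0 fk].
by split; [exact: opnorm_nonempty|exists k; exact: opnorm_ubound].
Qed.

Lemma opnorm_ge0 f : bounded_map f -> 0 <= opnorm f.
Proof.
move=> bf; apply: (@le_trans _ _ (complex.Re `|f 0|)).
  by rewrite -lecR Re_normE normr_ge0.
apply: (ub_le_sup (opnorm_has_sup bf).2); exists 0 => //=.
by rewrite normr0 ler01.
Qed.

Lemma ler_opnorm f : linear f -> bounded_map f ->
  forall x, `|f x| <= (opnorm f)%:C * `|x|.
Proof.
move=> lf bf x.
have fZ k y : f (k *: y) = k *: f y.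
  have f0 : f 0 = 0.
    by have := lf (-1) 0 0; rewrite scaler0 addr0 scaleN1r addNr.
  by have := lf k y 0; rewrite !addr0 f0 addr0.
have [->|x0] := eqVneq x 0.
  have -> : f 0 = 0 by have := fZ 0 0; rewrite !scale0r.
  by rewrite !normr0 mulr0.
have nx0 : `|x| != 0 by rewrite normr_eq0.
have -> : f x = `|x| *: f (`|x|^-1 *: x).
  by rewrite -fZ scalerA divff// scale1r.
rewrite normrZ normr_id mulrC.
rewrite ler_wpM2r// -(Re_normE (f _)) lecR.
apply: (ub_le_sup (opnorm_has_sup bf).2); exists (`|x|^-1 *: x) => //=.
by rewrite normrZ normfV normr_id mulVf.
Qed.

End opnorm.

(* A multiplier of A is a double centralizer: a pair (L, T) of bounded linear
   maps such that a L(b) = T(a) b. *)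
Record multiplier (R : realType) (A : cstarType R) := Multiplier {
  lmult : A -> A;
  rmult : A -> A;
  lmult_linear : linear lmult;
  rmult_linear : linear rmult;
  lmult_bounded : bounded_map lmult;
  rmult_bounded : bounded_map rmult;
  rmult_lmult : forall a b : A, a ** lmult b = rmult a ** b
}.

Section multiplier_algebra.
Context {R : realType} {A : cstarType R}.
Notation M := (multiplier A).
Implicit Types (m : M) (f g : A -> A).

HB.instance Definition _ := gen_eqMixin M.
HB.instance Definition _ := gen_choiceMixin M.

Lemma multiplierP m1 m2 :
  lmult m1 =1 lmult m2 -> rmult m1 =1 rmult m2 -> m1 = m2.
Proof.
case: m1 => l1 r1 ll1 lr1 bl1 br1 e1; case: m2 => l2 r2 ll2 lr2 bl2 br2 e2 /=.
move=> /funext l12 /funext r12; move: ll1 lr1 bl1 br1 e1 ll2 lr2 bl2 br2 e2.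
by rewrite l12 r12 => *; congr Multiplier; exact: Prop_irrelevance.
Qed.

Lemma linear_zero_map : linear (fun _ : A => 0 : A).
Proof. by move=> k x y; rewrite scaler0 addr0. Qed.

Lemma linear_add_map f g : linear f -> linear g -> linear (fun x => f x + g x).
Proof. by move=> lf lg k x y; rewrite lf lg scalerDr addrACA. Qed.

Lemma linear_scale_map (k : R[i]) f : linear f -> linear (fun x => k *: f x).
Proof. by move=> lf l x y; rewrite lf scalerDr !scalerA mulrC. Qed.

Lemma linear_comp_map f g : linear f -> linear g -> linear (fun x => f (g x)).
Proof. by move=> lf lg k x y; rewrite lg lf. Qed.

Lemma bounded_zero_map : bounded_map (fun _ : A => 0 : A).
Proof. by exists 0 => x; rewrite normr0 mul0r. Qed.

Lemma bounded_add_map f g :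
  bounded_map f -> bounded_map g -> bounded_map (fun x => f x + g x).
Proof.
move=> [k fk] [l gl]; exists (k + l) => x.
by rewrite (le_trans (ler_normD _ _))// rmorphD mulrDl lerD.
Qed.

Lemma bounded_scale_map (k : R[i]) f :
  bounded_map f -> bounded_map (fun x => k *: f x).
Proof.
move=> [l fl]; exists (complex.Re `|k| * l) => x.
by rewrite normrZ RtoCM RRe_real ?normr_real// -mulrA ler_wpM2l.
Qed.

Lemma bounded_comp_map f g :
  bounded_map f -> bounded_map g -> bounded_map (fun x => f (g x)).
Proof.
move=> /bounded_map_ge0[k k0 fk] [l gl]; exists (k * l) => x.
by rewrite (le_trans (fk _))// RtoCM -mulrA ler_wpM2l// lecR.
Qed.

Lemma amul0 (x : A) : x ** 0 = 0.
Proof. by have := scale_amulr 0 x 0; rewrite !scale0r. Qed.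

Lemma mul0a (x : A) : 0 ** x = 0.
Proof. by have := scale_amull 0 0 x; rewrite !scale0r. Qed.

Fact multiplier_zero_subproof (a b : A) : a ** 0 = 0 ** b.
Proof. by rewrite amul0 mul0a. Qed.

Definition multiplier_zero : M :=
  Multiplier linear_zero_map linear_zero_map
    bounded_zero_map bounded_zero_map multiplier_zero_subproof.

Fact multiplier_add_subproof m1 m2 (a b : A) :
  a ** (lmult m1 b + lmult m2 b) = (rmult m1 a + rmult m2 a) ** b.
Proof. by rewrite amulDr amulDl !rmult_lmult. Qed.

Definition multiplier_add m1 m2 : M :=
  Multiplier (linear_add_map (lmult_linear m1) (lmult_linear m2))
    (linear_add_map (rmult_linear m1) (rmult_linear m2))
    (bounded_add_map (lmult_bounded m1) (lmult_bounded m2))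
    (bounded_add_map (rmult_bounded m1) (rmult_bounded m2))
    (multiplier_add_subproof m1 m2).

Fact multiplier_scale_subproof (k : R[i]) m (a b : A) :
  a ** (k *: lmult m b) = (k *: rmult m a) ** b.
Proof. by rewrite scale_amull scale_amulr rmult_lmult. Qed.

Definition multiplier_scale (k : R[i]) m : M :=
  Multiplier (linear_scale_map k (lmult_linear m))
    (linear_scale_map k (rmult_linear m))
    (bounded_scale_map k (lmult_bounded m))
    (bounded_scale_map k (rmult_bounded m))
    (multiplier_scale_subproof k m).

Definition multiplier_opp m : M := multiplier_scale (-1) m.

Fact multiplier_mul_subproof m1 m2 (a b : A) :
  a ** lmult m1 (lmult m2 b) = rmult m2 (rmult m1 a) ** b.
Proof. by rewrite !rmult_lmult. Qed.

(* (L1, T1) (L2, T2) = (L1 o L2, T2 o T1) *)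
Definition multiplier_mul m1 m2 : M :=
  Multiplier (linear_comp_map (lmult_linear m1) (lmult_linear m2))
    (linear_comp_map (rmult_linear m2) (rmult_linear m1))
    (bounded_comp_map (lmult_bounded m1) (lmult_bounded m2))
    (bounded_comp_map (rmult_bounded m2) (rmult_bounded m1))
    (multiplier_mul_subproof m1 m2).

Lemma multiplier_addA : associative multiplier_add.
Proof. by move=> m1 m2 m3; apply: multiplierP => x /=; rewrite addrA. Qed.

Lemma multiplier_addC : commutative multiplier_add.
Proof. by move=> m1 m2; apply: multiplierP => x /=; rewrite addrC. Qed.

Lemma multiplier_add0 : left_id multiplier_zero multiplier_add.
Proof. by move=> m; apply: multiplierP => x /=; rewrite add0r. Qed.

Lemma multiplier_addN : left_inverse multiplier_zero multiplier_opp multiplier_add.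
Proof. by move=> m; apply: multiplierP => x /=; rewrite scaleN1r addNr. Qed.

HB.instance Definition _ := GRing.isZmodule.Build M
  multiplier_addA multiplier_addC multiplier_add0 multiplier_addN.

Lemma multiplier_scaleA (k l : R[i]) m :
  multiplier_scale k (multiplier_scale l m) = multiplier_scale (k * l) m.
Proof. by apply: multiplierP => x /=; rewrite scalerA. Qed.

Lemma multiplier_scale1 : left_id 1 multiplier_scale.
Proof. by move=> m; apply: multiplierP => x /=; rewrite scale1r. Qed.

Lemma multiplier_scaleDr : right_distributive multiplier_scale +%R.
Proof. by move=> k m1 m2; apply: multiplierP => x /=; rewrite scalerDr. Qed.

Lemma multiplier_scaleDl m : {morph multiplier_scale^~ m : k l / k + l}.
Proof. by move=> k l; apply: multiplierP => x /=; rewrite scalerDl. Qed.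

HB.instance Definition _ := GRing.Zmodule_isLmodule.Build R[i] M
  multiplier_scaleA multiplier_scale1 multiplier_scaleDr multiplier_scaleDl.

(* The norms of the two components of a double centralizer coincide. *)
Definition multiplier_norm m : R[i] := (opnorm (lmult m))%:C.

Lemma ler_multiplier_norm m x : `|lmult m x| <= multiplier_norm m * `|x|.
Proof. exact: ler_opnorm (lmult_linear m) (lmult_bounded m) x. Qed.

Lemma multiplier_norm_ge0 m : 0 <= multiplier_norm m.
Proof. by rewrite lecR; exact/opnorm_ge0/lmult_bounded. Qed.

Lemma multiplier_norm_le m (k : R[i]) : 0 <= k ->
  (forall x, `|lmult m x| <= k * `|x|) -> multiplier_norm m <= k.
Proof.
move=> k0 mk; have kE : (complex.Re k)%:C = k by rewrite RRe_real ?ger0_real.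
rewrite -kE lecR; apply: opnorm_le; first by move=> x; rewrite kE.
by rewrite -lecR kE.
Qed.

Lemma multiplier_ler_normD m1 m2 :
  multiplier_norm (m1 + m2) <= multiplier_norm m1 + multiplier_norm m2.
Proof.
apply: multiplier_norm_le; first by rewrite addr_ge0// multiplier_norm_ge0.
move=> x; rewrite (le_trans (ler_normD _ _))//.
by rewrite mulrDl lerD ?ler_multiplier_norm.
Qed.

Lemma multiplier_normrZ_le (k : R[i]) m :
  multiplier_norm (k *: m) <= `|k| * multiplier_norm m.
Proof.
apply: multiplier_norm_le; first by rewrite mulr_ge0// multiplier_norm_ge0.
by move=> x /=; rewrite normrZ -mulrA ler_wpM2l// ler_multiplier_norm.
Qed.

Lemma multiplier_normrZ (k : R[i]) m :
  multiplier_norm (k *: m) = `|k| * multiplier_norm m.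
Proof.
apply/eqP; rewrite eq_le multiplier_normrZ_le/=.
have [->|k0] := eqVneq k 0; first by rewrite normr0 mul0r multiplier_norm_ge0.
rewrite mulrC -ler_pdivlMr ?normr_gt0// mulrC -normfV.
by rewrite -{1}(scale1r m) -(mulVf k0) -scalerA multiplier_normrZ_le.
Qed.

Lemma multiplier_normr0_eq0 m : multiplier_norm m = 0 -> m = 0.
Proof.
move=> m0; have l0 x : lmult m x = 0.
  by apply/normr0_eq0/le_anti; rewrite normr_ge0 andbT -[leRHS](mul0r `|x|) -m0
    ler_multiplier_norm.
apply: multiplierP => x /=; first exact: l0.
have rx0 : star (rmult m x) = 0.
  apply/normr0_eq0/eqP; rewrite -sqrf_eq0 -norm_starM starK.
  by rewrite -rmult_lmult l0 amul0 normr0.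
rewrite -[LHS]starK rx0.
by apply: (@addrI _ (star 0)); rewrite -starD !addr0.
Qed.

HB.instance Definition _ := Lmodule_isNormed.Build R[i] M
  multiplier_ler_normD multiplier_normrZ multiplier_normr0_eq0.

Lemma multiplier_mulA : associative multiplier_mul.
Proof. by move=> m1 m2 m3; exact: multiplierP. Qed.

Lemma multiplier_mulDl : left_distributive multiplier_mul +%R.
Proof.
move=> m1 m2 m3; apply: multiplierP => x //=.
by have := rmult_linear m3 1 (rmult m1 x) (rmult m2 x); rewrite !scale1r.
Qed.

Lemma multiplier_mulDr : right_distributive multiplier_mul +%R.
Proof.
move=> m1 m2 m3; apply: multiplierP => x //=.
by have := lmult_linear m1 1 (lmult m2 x) (lmult m3 x); rewrite !scale1r.
Qed.

Lemma linear_scale f (k : R[i]) x : linear f -> f (k *: x) = k *: f x.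
Proof.
move=> lf; have f0 : f 0 = 0.
  by have := lf (-1) 0 0; rewrite scaler0 addr0 scaleN1r addNr.
by have := lf k x 0; rewrite !addr0 f0 addr0.
Qed.

Lemma multiplier_scale_mull (k : R[i]) m1 m2 :
  multiplier_mul (k *: m1) m2 = k *: multiplier_mul m1 m2.
Proof.
apply: multiplierP => x //=; exact/linear_scale/rmult_linear.
Qed.

Lemma multiplier_scale_mulr (k : R[i]) m1 m2 :
  multiplier_mul m1 (k *: m2) = k *: multiplier_mul m1 m2.
Proof.
apply: multiplierP => x //=; exact/linear_scale/lmult_linear.
Qed.

Lemma multiplier_ler_norm_mul m1 m2 : `|multiplier_mul m1 m2| <= `|m1| * `|m2|.
Proof.
apply: multiplier_norm_le; first by rewrite mulr_ge0// multiplier_norm_ge0.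
move=> x /=; rewrite (le_trans (ler_multiplier_norm _ _))// -mulrA.
by rewrite ler_wpM2l ?multiplier_norm_ge0// ler_multiplier_norm.
Qed.

HB.instance Definition _ := NormedModule_isNormedAlgebra.Build R[i] M
  multiplier_mulA multiplier_mulDl multiplier_mulDr
  multiplier_scale_mull multiplier_scale_mulr multiplier_ler_norm_mul.

End multiplier_algebra.

Section canonical_maps.
Context {R : realType} {A : cstarType R}.

Lemma amul_linear (a : A) : linear (amul a).
Proof. by move=> k x y; rewrite amulDr scale_amulr. Qed.

Lemma amul_linearr (a : A) : linear (amul^~ a).
Proof. by move=> k x y; rewrite amulDl scale_amull. Qed.

Lemma amul_bounded (a : A) : bounded_map (amul a).
Proof. by exists (complex.Re `|a|) => x; rewrite Re_normE ler_norm_amul. Qed.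

Lemma amul_boundedr (a : A) : bounded_map (amul^~ a).
Proof.
by exists (complex.Re `|a|) => x; rewrite Re_normE mulrC ler_norm_amul.
Qed.

(* The canonical embedding of A in its multiplier algebra. *)
Definition to_multiplier (a : A) : multiplier A :=
  Multiplier (amul_linear a) (amul_linearr a) (amul_bounded a) (amul_boundedr a)
    (fun x y => amulA x a y).

Variables I B : subCStar A.
Hypothesis (BI : forall b x, subCStar_set B b -> subCStar_set I x ->
    subCStar_set I (b ** x) /\ subCStar_set I (x ** b)).

Definition ideal_lmul (b : B) (x : I) : I :=
  SubCStarElt (asboolT (BI (cval_set b) (cval_set x)).1).

Definition ideal_rmul (b : B) (x : I) : I :=
  SubCStarElt (asboolT (BI (cval_set b) (cval_set x)).2).

Lemma ideal_lmul_linear b : linear (ideal_lmul b).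
Proof. by move=> k x y; apply: val_inj; exact: amul_linear. Qed.

Lemma ideal_rmul_linear b : linear (ideal_rmul b).
Proof. by move=> k x y; apply: val_inj; exact: amul_linearr. Qed.

Lemma ideal_lmul_bounded b : bounded_map (ideal_lmul b).
Proof. by have [k bk] := amul_bounded (cval b); exists k => x; exact: bk. Qed.

Lemma ideal_rmul_bounded b : bounded_map (ideal_rmul b).
Proof. by have [k bk] := amul_boundedr (cval b); exists k => x; exact: bk. Qed.

Lemma ideal_mulE b (x y : I) : x ** ideal_lmul b y = ideal_rmul b x ** y.
Proof. by apply: val_inj; exact: amulA. Qed.

(* For I an ideal of B, the homomorphism B -> M(I), b |-> (x |-> b x, x |-> x b). *)
Definition ideal_multiplier (b : B) : multiplier I :=
  Multiplier (ideal_lmul_linear b) (ideal_rmul_linear b)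
    (ideal_lmul_bounded b) (ideal_rmul_bounded b) (ideal_mulE b).

End canonical_maps.

Section closed_span.
Context {R : realType} {A : cstarType R}.
Implicit Types (X Y : set A) (f : A -> A).

Definition cspan X : set A :=
  [set v | exists2 s : seq (R[i] * A), (forall p, p \in s -> X p.2) &
    v = \sum_(p <- s) p.1 *: p.2].

Definition closed_span X : set A := closure (cspan X).

Lemma cspan0 X : cspan X 0.
Proof. by exists [::] => //; rewrite big_nil. Qed.

Lemma cspanD X x y : cspan X x -> cspan X y -> cspan X (x + y).
Proof.
move=> [s sX ->] [t tX ->]; exists (s ++ t); last by rewrite big_cat.
by move=> p; rewrite mem_cat => /orP[/sX|/tX].
Qed.

Lemma cspanZ X (k : R[i]) x : cspan X x -> cspan X (k *: x).
Proof.
move=> [s sX ->]; exists [seq (k * p.1, p.2) | p <- s].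
  by move=> _ /mapP[p /sX Xp ->].
by rewrite big_map scaler_sumr; apply: eq_bigr => p _; rewrite scalerA.
Qed.

Lemma sub_cspan X : X `<=` cspan X.
Proof.
move=> x Xx; exists [:: (1, x)]; last by rewrite big_seq1 scale1r.
by move=> p; rewrite inE => /eqP ->.
Qed.

Lemma cspan_ind X Y : Y 0 -> (forall x y, Y x -> Y y -> Y (x + y)) ->
  (forall (k : R[i]) x, X x -> Y (k *: x)) -> cspan X `<=` Y.
Proof.
move=> Y0 YD YZ _ [s sX ->]; rewrite big_seq.
by apply: big_ind => // p /sX; exact: YZ.
Qed.

Lemma lipschitz_continuous f (M : R[i]) : 0 <= M ->
  (forall x y, `|f x - f y| <= M * `|x - y|) -> continuous f.
Proof.
move=> M0 fM x; apply/cvgrPdist_lt => e e0.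
have M1 : 0 < M + 1 by rewrite ltr_wpDl.
near=> y; rewrite (le_lt_trans (fM _ _))//.
apply: (@le_lt_trans _ _ ((M + 1) * `|x - y|)).
  by rewrite ler_wpM2r// lerDl.
rewrite mulrC -ltr_pdivlMr//; near: y.
by apply: cvgr_dist_lt; [exact: cvg_id|exact: divr_gt0].
Unshelve. all: by end_near. Qed.

Lemma amul_continuous (a : A) : continuous (amul a).
Proof.
apply: (@lipschitz_continuous _ `|a|) => // x y.
have -> : a ** x - a ** y = a ** (x - y).
  by rewrite amulDr -[- y]scaleN1r scale_amulr scaleN1r.
exact: ler_norm_amul.
Qed.

Lemma amul_continuousr (a : A) : continuous (amul^~ a).
Proof.
apply: (@lipschitz_continuous _ `|a|) => // x y.
have -> : x ** a - y ** a = (x - y) ** a.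
  by rewrite amulDl -[- y]scaleN1r scale_amull scaleN1r.
by rewrite mulrC; exact: ler_norm_amul.
Qed.

Lemma ler_norm_star (x : A) : `|star x| <= `|x|.
Proof.
have [->|x0] := eqVneq (star x) 0; first by rewrite normr0.
rewrite -(@ler_pM2r _ `|star x|) ?normr_gt0// -expr2 -norm_starM starK.
exact: ler_norm_amul.
Qed.

Lemma starN (x : A) : star (- x) = - star x.
Proof.
apply/eqP; rewrite -addr_eq0 -starD addNr; apply/eqP.
by apply: (@addrI _ (star 0)); rewrite -starD !addr0.
Qed.

Lemma star_continuous : continuous (@star R A).
Proof.
apply: (@lipschitz_continuous _ 1) => // x y.
by rewrite mul1r -starN -starD ler_norm_star.
Qed.

Lemma closure_stable f X Y : continuous f -> closed Y ->
  (forall x, X x -> Y (f x)) -> forall x, closure X x -> Y (f x).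
Proof.
move=> /continuous_closedP/(_ Y) cf /cf cY XY; rewrite closureE.
exact: smallest_sub.
Qed.

Section closed_span_subCStar.
Variable X : set A.
Hypothesis XM : forall x y, X x -> X y -> X (x ** y).
Hypothesis Xstar : forall x, X x -> X (star x).

Let closed_span_closed : closed (closed_span X).
Proof. exact: closed_closure. Qed.

Let sub_closed_span : X `<=` closed_span X.
Proof. by move=> x /sub_cspan; exact: subset_closure. Qed.

Let closed_span0 : closed_span X 0.
Proof. exact/subset_closure/cspan0. Qed.

Let closed_spanD x y :
  closed_span X x -> closed_span X y -> closed_span X (x + y).
Proof.
move=> Xx; move: y; apply: (@closure_stable (fun y => x + y)) => //.
  by apply: (@lipschitz_continuous _ 1) => // y z; rewrite mul1r opprD addrACA subrr add0r.
move=> y Xy; move: x Xx; apply: (@closure_stable (fun x => x + y)) => //.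
  by apply: (@lipschitz_continuous _ 1) => // x z; rewrite mul1r opprD addrACA subrr addr0.
by move=> x Xx; exact/subset_closure/cspanD.
Qed.

Let closed_spanZ (k : R[i]) x : closed_span X x -> closed_span X (k *: x).
Proof.
move: x; apply: (@closure_stable (fun x => k *: x)) => //.
  by apply: (@lipschitz_continuous _ `|k|) => // x y; rewrite -scalerBr normrZ.
by move=> x Xx; exact/subset_closure/cspanZ.
Qed.

Let closed_spanM x y :
  closed_span X x -> closed_span X y -> closed_span X (x ** y).
Proof.
have MXX u v : X u -> cspan X v -> closed_span X (u ** v).
  move=> Xu; move: v; apply: cspan_ind.
  - by rewrite amul0.
  - by move=> v w; rewrite amulDr; exact: closed_spanD.
  - move=> k v Xv; rewrite scale_amulr; apply: closed_spanZ.
    exact/sub_closed_span/XM.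
move=> Xx; move: y; apply: closure_stable => //; first exact: amul_continuous.
move=> y Xy; move: x Xx; apply: (@closure_stable (amul^~ y)) => //.
  exact: amul_continuousr.
apply: cspan_ind.
- by rewrite mul0a.
- by move=> v w; rewrite amulDl; exact: closed_spanD.
- by move=> k v Xv; rewrite scale_amull; exact/closed_spanZ/MXX.
Qed.

Let closed_span_star x : closed_span X x -> closed_span X (star x).
Proof.
move: x; apply: closure_stable => //; first exact: star_continuous.
apply: cspan_ind.
- by rewrite (_ : star 0 = 0)//; apply: (@addrI _ (star 0)); rewrite -starD !addr0.
- by move=> v w; rewrite starD; exact: closed_spanD.
- by move=> k v Xv; rewrite starZ; exact/closed_spanZ/sub_closed_span/Xstar.
Qed.

Definition closed_span_subCStar : subCStar A :=
  SubCStar closed_span_closed closed_span0 closed_spanD closed_spanZ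
    closed_spanM closed_span_star.

End closed_span_subCStar.

End closed_span.

Section semilattice.
Context {d : Order.disp_t} {L : meetSemilatticeType d}.
Local Open Scope order_scope.

Definition totally_ordered (S : set L) := forall i j, S i -> S j -> i >=< j.

Definition well_ordered (S : set L) :=
  forall T, T `<=` S -> T !=set0 -> exists2 m, T m & forall i, T i -> m <= i.

End semilattice.

Definition good_semilattice d (L : meetSemilatticeType d) :=
  forall S : set L, S !=set0 -> totally_ordered S -> well_ordered S.

Section graded.
Context {R : realType} {d : Order.disp_t} {L : meetSemilatticeType d}.
Context {A : cstarType R}.

Record graded (A_ : L -> subCStar A) : Prop := Graded {
  graded_free : forall s : L -> A, (forall i, subCStar_set (A_ i) (s i)) ->
    finite_set [set i | s i != 0] -> \sum_(i \in [set: L]) s i = 0 ->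
    forall i, s i = 0;
  graded_total : dense (cspan (\bigcup_i subCStar_set (A_ i)));
  gradedM : forall i j x y, subCStar_set (A_ i) x -> subCStar_set (A_ j) y ->
    subCStar_set (A_ (i `&` j)%O) (x ** y)
}.

Variable A_ : L -> subCStar A.
Hypothesis gA : graded A_.

Definition above_set (i : L) : set A :=
  \bigcup_(j in [set j | (i <= j)%O]) subCStar_set (A_ j).

Lemma above_setM i x y : above_set i x -> above_set i y -> above_set i (x ** y).
Proof.
move=> [j /= ij jx] [k /= ik ky]; exists (j `&` k)%O; last exact: gradedM.
by rewrite /= lexI ij.
Qed.

Lemma above_set_star i x : above_set i x -> above_set i (star x).
Proof. by move=> [j /= ij jx]; exists j => //; exact: subCStar_star. Qed.

(* The closure of the direct sum of the components A_j for i <= j. *)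
Definition above (i : L) : subCStar A :=
  closed_span_subCStar (@above_setM i) (@above_set_star i).

Lemma above_ideal i b x :
  subCStar_set (above i) b -> subCStar_set (A_ i) x ->
  subCStar_set (A_ i) (b ** x) /\ subCStar_set (A_ i) (x ** b).
Proof.
move=> ib ix; split.
- apply: (@closure_stable _ _ (amul^~ x) (cspan (above_set i))
    (subCStar_set (A_ i))) ib; first exact: amul_continuousr.
    exact: subCStar_closed.
  apply: cspan_ind.
  + by rewrite mul0a; exact: subCStar0.
  + by move=> v w; rewrite amulDl; exact: subCStarD.
  + move=> k v [j /= ij jv]; rewrite scale_amull; apply: subCStarZ.
    by have := gradedM gA jv ix; rewrite (meet_idPr ij).
- apply: (@closure_stable _ _ (amul x) (cspan (above_set i))
    (subCStar_set (A_ i))) ib; first exact: amul_continuous.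
    exact: subCStar_closed.
  apply: cspan_ind.
  + by rewrite amul0; exact: subCStar0.
  + by move=> v w; rewrite amulDr; exact: subCStarD.
  + move=> k v [j /= ij jv]; rewrite scale_amulr; apply: subCStarZ.
    by have := gradedM gA ix jv; rewrite (meet_idPl ij).
Qed.

Definition is_proj (i : L) (p : A -> above i) :=
  [/\ star_hom p,
      forall j x, (i <= j)%O -> subCStar_set (A_ j) x -> cval (p x) = x &
      forall j x, ~~ (i <= j)%O -> subCStar_set (A_ j) x -> p x = 0].
Arguments is_proj : clear implicits.

(* The unique homomorphism satisfying [is_proj i]; being unique, it is the one
   that [xget] selects. *)
Definition proj (i : L) : A -> above i := xget (fun=> 0) [set p | is_proj i p].

Definition phi (i : L) : above i -> multiplier (A_ i) :=
  ideal_multiplier (@above_ideal i).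
Arguments phi : clear implicits.

Definition ppi (i : L) : A -> multiplier (A_ i) := phi i \o proj i.

End graded.

Arguments proj {R d L A A_} gA i _.
Arguments phi {R d L A A_} gA i _.
Arguments ppi {R d L A A_} gA i _.

(* The unique character of M(A) extending the character chi of A. *)
Definition char_ext (R : realType) (A : cstarType R) (chi : A -> R[i]) :
    multiplier A -> R[i] :=
  xget (fun=> 0)
    [set f | Sp (multiplier A) f /\ forall a, f (to_multiplier a) = chi a].

Definition psi (R : realType) (d : Order.disp_t) (L : meetSemilatticeType d)
    (A : cstarType R) (A_ : L -> subCStar A) (gA : graded A_) (i : L)
    (chi : A_ i -> R[i]) : A -> R[i] :=
  char_ext chi \o ppi gA i.
Arguments psi {R d L A A_} gA i chi _.

(* Main.v *)
From HB Require Import structures.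
Require Import Defs.
From mathcomp Require Import all_boot all_order all_algebra.
From mathcomp Require Import all_classical all_reals.
From mathcomp Require Import topology normedtype.
From mathcomp Require Import complex ring lra.

(** Let [chi] be a character of the graded algebra.  The indices [j] such that
    [chi] is not zero on [A_ j] form a set that is nonempty, because the
    components are total, and stable under meets, because [chi] is
    multiplicative.  In a good semilattice such a set has a least element [i]
    ([good_minimum]).  Then [chi] vanishes on the components that the projection
    onto the upper subalgebra of [i] kills, so it factors through this
    projection; being nonzero on the ideal [A_ i], it is determined there by its
    restriction to [A_ i], and is the image of that restriction under [psi]
    ([psi_restriction]).  Conversely, [psi] is given by
    [psi chi x * chi a = chi (p x ** a)], where [p] is the projection, which
    makes it a character ([psi_character]).

    The substance is the existence of the projections, as continuous maps
    ([exists_proj]).  The span of the components over the indices above [i] is a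
    subalgebra [B], and the span of the others an ideal [I]; one needs
    [`|b| <= `|b + g|] for [b] in [B] and [g] in [I] ([separation_cspan]).  For
    a closed subalgebra and a closed ideal meeting trivially, this is the fact
    that injective homomorphisms are isometric ([separation]); it is obtained
    here without spectra, from a cutoff function of a self-adjoint element.  The
    cutoff comes from an absolute value, itself a square root of a
    contraction produced by a convergent iteration ([square_root],
    [absolute_value]); positivity enters only through the remark that
    a sine and a cosine combine into an isometry ([rotation_isometry]).

    The spans need not be closed, so one first treats finite meet-stable sets of
    indices.  The span is then closed by induction on the number of indices:
    removing a maximal index leaves an ideal, and the estimate just described
    makes the sum of this ideal and the remaining component closed
    ([closed_span_finite]).  Since every element of the span lives over a finite
    meet-stable set, the estimate follows for all spans, and passes to
    closures. *)

Set Implicit Arguments.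
Unset Strict Implicit.
Unset Printing Implicit Defensive.

Import Order.TTheory GRing.Theory Num.Theory.
Import numFieldNormedType.Exports.

Local Open Scope classical_set_scope.
Local Open Scope ring_scope.
Local Open Scope complex_scope.

(** * Real-valued norms *)

Section real_norm.
Context {R : realType} {V : normedModType R[i]}.
Implicit Types (x y : V).

(** Norms over [R[i]] take values in [R[i]], which is only partially ordered;
    the same quantity read in [R] is accessible to linear arithmetic. *)
Definition rnorm x : R := complex.Re `|x|.

Lemma rnormE x : (rnorm x)%:C = `|x|.
Proof. by rewrite /rnorm RRe_real// normr_real. Qed.

Lemma rnorm_ge0 x : 0 <= rnorm x.
Proof. by rewrite -lecR rnormE normr_ge0. Qed.

Lemma rnorm0 : rnorm 0 = 0.
Proof. by rewrite /rnorm normr0. Qed.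

Lemma rnorm_eq0 x : rnorm x = 0 -> x = 0.
Proof. by move=> x0; apply: normr0_eq0; rewrite -rnormE x0. Qed.

Lemma rnormN x : rnorm (- x) = rnorm x.
Proof. by rewrite /rnorm normrN. Qed.

Lemma rnormB x y : rnorm (x - y) = rnorm (y - x).
Proof. by rewrite -rnormN opprB. Qed.

Lemma rnormD x y : rnorm (x + y) <= rnorm x + rnorm y.
Proof. by rewrite -lecR rmorphD /= !rnormE ler_normD. Qed.

Lemma rnorm_dist x y z : rnorm (x - z) <= rnorm (x - y) + rnorm (y - z).
Proof. by rewrite -[x - z](subrKA y) rnormD. Qed.

Lemma rnormZ (k : R[i]) x : rnorm (k *: x) = complex.Re `|k| * rnorm x.
Proof.
apply: (@complexI R); rewrite rmorphM /= !rnormE normrZ.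
by rewrite (RRe_real (normr_real k)).
Qed.

Lemma rnormZr (k : R) x : rnorm (k%:C *: x) = `|k| * rnorm x.
Proof. by rewrite rnormZ normc_def /= expr0n addr0 sqrtr_sqr. Qed.

Lemma rnorm_double x : rnorm (x + x) = rnorm x + rnorm x.
Proof.
have -> : x + x = (2 : R)%:C *: x.
  by rewrite [X in X%:C](_ : 2 = 1 + 1)// rmorphD /= scalerDl scale1r.
by rewrite rnormZr ger0_norm//; lra.
Qed.

Lemma scale_half_double x : (2^-1)%:C *: (x + x) = x.
Proof.
rewrite scalerDr -scalerDl -rmorphD /= [X in X%:C](_ : _ = 1); last by lra.
by rewrite scale1r.
Qed.

Lemma rnorm_ltP x (e : R) : (rnorm x < e) = (`|x| < e%:C).
Proof. by rewrite -rnormE ltcR. Qed.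

End real_norm.

Section cstar_norm.
Context {R : realType} {A : cstarType R}.
Implicit Types (x y : A).

Lemma rnormM x y : rnorm (x ** y) <= rnorm x * rnorm y.
Proof. by rewrite -lecR rmorphM /= !rnormE ler_norm_amul. Qed.

Lemma rnorm_starM x : rnorm (star x ** x) = rnorm x ^+ 2.
Proof. by apply: (@complexI R); rewrite rmorphXn /= !rnormE norm_starM. Qed.

Lemma rnorm_star x : rnorm (star x) = rnorm x.
Proof.
apply: le_anti; rewrite -!lecR !rnormE ler_norm_star.
by rewrite -{1}(starK x) ler_norm_star.
Qed.

Lemma rnorm_sqr x : star x = x -> rnorm (x ** x) = rnorm x ^+ 2.
Proof. by move=> sx; rewrite -rnorm_starM sx. Qed.

Lemma starZr (k : R) x : star (k%:C *: x) = k%:C *: star x.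
Proof. by rewrite starZ; congr (_ *: _); exact: conjc_real. Qed.

Lemma starB x y : star (x - y) = star x - star y.
Proof. by rewrite starD starN. Qed.

Lemma star0 : star (0 : A) = 0.
Proof. by rewrite -[X in star X](subrr 0) starB subrr. Qed.

Lemma amulN x y : x ** - y = - (x ** y).
Proof. by rewrite -scaleN1r scale_amulr scaleN1r. Qed.

Lemma amulBr x y z : x ** (y - z) = x ** y - x ** z.
Proof. by rewrite amulDr amulN. Qed.

Lemma mulNa x y : - x ** y = - (x ** y).
Proof. by rewrite -scaleN1r scale_amull scaleN1r. Qed.

Lemma amulBl x y z : (x - y) ** z = x ** z - y ** z.
Proof. by rewrite amulDl mulNa. Qed.

End cstar_norm.

(** * The unitization of a commutative algebra *)

Section unitization.
Context {R : realType} {A : cstarType R}.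
Hypothesis AC : commutative (@amul _ A).

(** The pair [(k, a)] stands for [k + a].  The elements of [A] embed in this
    unital commutative ring, so a polynomial identity between them may be
    verified there by ring normalization.  The proof of commutativity is a
    parameter so that the ring structure can be inferred from the type. *)
Definition unitization of commutative (@amul _ A) := (R[i] * A)%type.
Local Notation U := (unitization AC).

HB.instance Definition _ := GRing.Zmodule.on U.

Definition unitization_mul (x y : U) : U :=
  (x.1 * y.1, x.1 *: y.2 + y.1 *: x.2 + x.2 ** y.2).

Fact unitization_mulA : associative unitization_mul.
Proof.
move=> x y z; congr pair; rewrite /= ?mulrA//.
rewrite !scalerDr !amulDr !amulDl !scale_amull !scale_amulr !scalerA amulA.
rewrite (mulrC z.1 x.1) (mulrC z.1 y.1) -!addrA; do 2 congr (_ + _).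
rewrite [LHS]addrCA; congr (_ + _).
rewrite [RHS]addrCA; congr (_ + _).
by rewrite addrCA.
Qed.

Fact unitization_mulC : commutative unitization_mul.
Proof.
by move=> x y; congr pair; rewrite /= 1?mulrC 1?(addrC (x.1 *: _)) 1?AC.
Qed.

Fact unitization_mul1 : left_id ((1, 0) : U) unitization_mul.
Proof.
case=> k a; congr pair; rewrite /= ?mul1r//.
by rewrite scale1r scaler0 addr0 mul0a addr0.
Qed.

Fact unitization_mulDl : left_distributive unitization_mul +%R.
Proof.
move=> x y z; congr pair; rewrite /= ?mulrDl//.
rewrite scalerDl scalerDr amulDl -!addrA; congr (_ + _).
rewrite addrCA; congr (_ + _); rewrite [RHS]addrCA; congr (_ + _).
by rewrite addrCA.
Qed.

Fact unitization_neq0 : ((1, 0) : U) != 0.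
Proof. by apply/eqP => -[/eqP]; rewrite oner_eq0. Qed.

HB.instance Definition _ := GRing.Zmodule_isComNzRing.Build U
  unitization_mulA unitization_mulC unitization_mul1 unitization_mulDl
  unitization_neq0.

Definition inU (a : A) : U := (0, a).
Definition scU (k : R[i]) : U := (k, 0).

Lemma inU_inj : injective inU. Proof. by move=> a b []. Qed.

Lemma inUD a b : inU (a + b) = inU a + inU b.
Proof. by congr pair; rewrite /= addr0. Qed.

Lemma inUN a : inU (- a) = - inU a.
Proof. by congr pair; rewrite /= oppr0. Qed.

Lemma inUM a b : inU (a ** b) = inU a * inU b.
Proof. by congr pair; rewrite /= ?mul0r// !scale0r !add0r. Qed.

Lemma inUZ k a : inU (k *: a) = scU k * inU a.
Proof. by congr pair; rewrite /= ?mulr0// scale0r mul0a !addr0. Qed.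

Lemma scUM k l : scU (k * l) = scU k * scU l.
Proof. by congr pair; rewrite /= !scaler0 amul0 !addr0. Qed.

Lemma scUN k : scU (- k) = - scU k.
Proof. by congr pair; rewrite /= oppr0. Qed.

Lemma scU1 : scU 1 = 1. Proof. by []. Qed.

Definition inUE := (inUD, inUN, inUM, inUZ, scUM, scUN, scU1).

End unitization.

(** * Closures and limits *)

Lemma complex_gt0 (R : realType) (e : R[i]) :
  0 < e -> e = (complex.Re e)%:C /\ 0 < complex.Re e.
Proof.
move=> e0; have eE : (complex.Re e)%:C = e by rewrite RRe_real// gtr0_real.
by split=> //; rewrite -ltcR eE.
Qed.

Section topology.
Context {R : realType} {A : cstarType R}.
Implicit Types (x y : A) (X : set A).

Lemma closure_rnormP X x :
  closure X x <-> forall e : R, 0 < e -> exists2 y, X y & rnorm (x - y) < e.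
Proof.
split=> [Xx e e0|Xx B /nbhs_ballP[e /= e0 eB]].
  have e0' : 0 < e%:C by rewrite ltcR.
  have [y [Xy]] := Xx _ (nbhsx_ballx x _ e0').
  by rewrite -ball_normE /= -rnorm_ltP => xy; exists y.
have [eE e0'] := complex_gt0 e0.
have [y Xy xy] := Xx _ e0'; exists y; split=> //; apply: eB.
by rewrite -ball_normE /= eE -rnorm_ltP.
Qed.

Lemma closed_rnorm X x : closed X ->
  (forall e : R, 0 < e -> exists2 y, X y & rnorm (x - y) < e) -> X x.
Proof. by move=> cX /closure_rnormP; exact: cX. Qed.

Lemma rnorm_lt_all x : (forall e : R, 0 < e -> rnorm x < e) -> x = 0.
Proof.
move=> xe; apply: rnorm_eq0; apply: le_anti; rewrite rnorm_ge0 andbT.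
by apply/ler_addgt0Pr => e e0; rewrite add0r ltW ?xe.
Qed.

Lemma cauchy_limit (u : nat -> A) :
  (forall e : R, 0 < e ->
    exists N, forall n, (N <= n)%N -> rnorm (u n - u N) < e) ->
  exists l, forall e : R, 0 < e ->
    exists N, forall n, (N <= n)%N -> rnorm (l - u n) < e.
Proof.
move=> uC; have ucvg : cvg (u n @[n --> \oo]).
  apply: cauchy_cvg; apply/cauchyP => e /complex_gt0[-> e0].
  have [N uN] := uC _ e0; exists (u N); exists N => // n /= Nn.
  by rewrite -ball_normE /= -rnorm_ltP rnormB uN.
exists (lim (u n @[n --> \oo])) => e e0.
have e0' : 0 < e%:C :> R[i] by rewrite ltcR.
have /cvgrPdist_lt/(_ _ e0')[N _ uN] := ucvg.
by exists N => n Nn; rewrite rnorm_ltP; exact: uN.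
Qed.

Lemma dominated_cauchy_limit (u : nat -> A) (t : nat -> R) (M : R) :
  (forall n, t n <= M) ->
  (forall m n, (m <= n)%N -> rnorm (u n - u m) <= t n - t m) ->
  exists l, forall e : R, 0 < e ->
    exists N, forall n, (N <= n)%N -> rnorm (l - u n) < e.
Proof.
move=> tM ut; apply: cauchy_limit => e e0.
have t_sup : has_sup (range t).
  by split; [exists (t 0%N), 0%N|exists M => _ [n _ <-]; exact: tM].
have [_ [N _ <-] tN] := sup_adherent e0 t_sup.
exists N => n Nn; rewrite (le_lt_trans (ut _ _ Nn))//.
rewrite ltrBlDr addrC (le_lt_trans _ (_ : sup (range t) < _))//; last by lra.
by apply: (ub_le_sup t_sup.2); exists n.
Qed.

End topology.

(** * Square roots of self-adjoint elements *)

Section square_root.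
Context {R : realType} {A : cstarType R}.
Hypothesis AC : commutative (@amul _ A).
Implicit Types (x y : A).

(** Iteration for the fixed point [y = (x + y ^ 2) / 2], equivalent to
    [(1 - y) ^ 2 = 1 - x].  The iterates are polynomials in [x] with nonnegative
    coefficients and without constant term, so they live in a nonunital algebra
    and their norms are controlled by the scalar iteration at [x = 1]. *)
Fixpoint sqrt_iter x n : A :=
  if n is k.+1 then (2^-1)%:C *: (x + sqrt_iter x k ** sqrt_iter x k) else 0.

Fixpoint sqrt_iterR n : R :=
  if n is k.+1 then 2^-1 * (1 + sqrt_iterR k * sqrt_iterR k) else 0.

Let s := sqrt_iterR.

Lemma sqrt_iterR_itv n : 0 <= s n <= 1.
Proof. by elim: n => [|n] /=; [lra|rewrite -/(s n) => ?; nra]. Qed.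

Lemma sqrt_iter_le x n : rnorm x <= 1 -> rnorm (sqrt_iter x n) <= s n.
Proof.
move=> x1; elim: n => [|n IH] /=; first by rewrite rnorm0.
rewrite rnormZr ger0_norm; last by lra.
rewrite ler_wpM2l//; first by lra.
rewrite (le_trans (rnormD _ _))// lerD// (le_trans (rnormM _ _))//.
by rewrite ler_pM ?rnorm_ge0.
Qed.

(** Both sides factor alike: consecutive differences satisfy
    [y'' - y' = (y' - y) (y' + y) / 2], for elements and for scalars. *)
Lemma sqrt_iterS_dist x n : rnorm x <= 1 ->
  rnorm (sqrt_iter x n.+1 - sqrt_iter x n) <= s n.+1 - s n.
Proof.
move=> x1; elim: n => [|n IH].
  rewrite /= subr0 amul0 addr0 rnormZr ger0_norm; lra.
set u := sqrt_iter x n.+1; set w := sqrt_iter x n.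
have -> : sqrt_iter x n.+2 - u = (2^-1)%:C *: ((u - w) ** (u + w)).
  rewrite [sqrt_iter _ _]/= {3}/u [sqrt_iter _ n.+1]/= -scalerBr -/u -/w.
  by congr (_ *: _); apply: (@inU_inj _ _ AC); rewrite !inUE; ring.
have -> : s n.+2 - s n.+1 = 2^-1 * ((s n.+1 - s n) * (s n.+1 + s n)).
  have sS k : s k.+1 = 2^-1 * (1 + s k * s k) by [].
  rewrite (sS n.+1) {3}sS; ring.
rewrite rnormZr ger0_norm; last by lra.
rewrite ler_wpM2l//; first by lra.
rewrite (le_trans (rnormM _ _))// ler_pM ?rnorm_ge0//.
by rewrite (le_trans (rnormD _ _))// lerD// sqrt_iter_le.
Qed.

Lemma sqrt_iter_dist x m n : rnorm x <= 1 -> (m <= n)%N ->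
  rnorm (sqrt_iter x n - sqrt_iter x m) <= s n - s m.
Proof.
move=> x1; elim: n => [|n IH].
  by rewrite leqn0 => /eqP ->; rewrite !subrr rnorm0.
rewrite leq_eqVlt ltnS => /predU1P[->|/IH mn].
  by rewrite !subrr rnorm0.
rewrite (le_trans (rnorm_dist _ (sqrt_iter x n) _))//.
have := sqrt_iterS_dist n x1; lra.
Qed.

Lemma sqrt_iter_star x n : star x = x -> star (sqrt_iter x n) = sqrt_iter x n.
Proof.
by move=> sx; elim: n => [|n IH] /=; rewrite ?star0// starZr starD starM sx IH.
Qed.

(** The element [1 - y] is the square root of [1 - x].  The bounded increasing
    scalar iteration dominates the one in [A], whose limit is a fixed point. *)
Lemma square_root x : star x = x -> rnorm x <= 1 ->
  exists y, [/\ star y = y, rnorm y <= 1 & y + y = x + y ** y].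
Proof.
move=> sx x1.
have s1 n : s n <= 1 by have /andP[] := sqrt_iterR_itv n.
have [y yP] := dominated_cauchy_limit s1 (fun m n => @sqrt_iter_dist x m n x1).
have y1 : rnorm y <= 1.
  apply/ler_addgt0Pr => e /yP[N /(_ N (leqnn N)) yN].
  have := rnormD (sqrt_iter x N) (y - sqrt_iter x N); rewrite subrKC.
  by have := sqrt_iter_le N x1; have := s1 N; lra.
exists y; split=> //.
  apply/eqP; rewrite -subr_eq0; apply/eqP/rnorm_lt_all => e e0.
  have e2 : 0 < e / 2 by lra.
  have [N /(_ N (leqnn N)) yN] := yP _ e2.
  have := rnorm_dist (star y) (sqrt_iter x N) y.
  rewrite -{1}(sqrt_iter_star N sx) -starB rnorm_star.
  by rewrite (rnormB (sqrt_iter x N) y); lra.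
apply/eqP; rewrite -subr_eq0; apply/eqP/rnorm_lt_all => e e0.
have e4 : 0 < e / 4 by lra.
have [N yN] := yP _ e4.
have yN0 := yN N (leqnn N); have yN1 := yN N.+1 (leqnSn N).
set u := sqrt_iter x N in yN0.
have uE : sqrt_iter x N.+1 + sqrt_iter x N.+1 = x + u ** u.
  have halves : (2^-1)%:C + (2^-1)%:C = 1 :> R[i].
    by rewrite -rmorphD /= [X in X%:C](_ : _ = 1)//; lra.
  by rewrite /= -scalerDl halves scale1r.
have -> : y + y - (x + y ** y) =
    (y - sqrt_iter x N.+1) + (y - sqrt_iter x N.+1) - (y - u) ** (y + u).
  rewrite addrACA -opprD uE.
  by apply: (@inU_inj _ _ AC); rewrite !inUE; ring.
set d := y - sqrt_iter x N.+1 in yN1 *.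
have du := rnormM (y - u) (y + u).
have yu : rnorm (y + u) <= 2.
  rewrite (le_trans (rnormD _ _))//; have := sqrt_iter_le N x1.
  by have := s1 N; rewrite -/u; lra.
have := rnormD (d + d) (- ((y - u) ** (y + u))); rewrite rnormN.
have := rnormD d d; have := rnorm_ge0 (y - u); nra.
Qed.

End square_root.

(** * Absolute values *)

Section cutoff.
Context {R : realType} {A : cstarType R}.
Hypothesis AC : commutative (@amul _ A).
Implicit Types (x y p m v w : A).

(** Where [1 - p] and [m] play the roles of the cosine and the sine of an angle,
    multiplication by [1 - p + k m] is isometric because
    [(1 - p - k m)(1 - p + k m) = (1 - p)^2 + m^2 = 1]. *)
Lemma rotation_isometry (k : R[i]) p m w : (k^*)%R = - k -> k * k = -1 ->
  star p = p -> star m = m -> p ** p + m ** m = p + p ->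
  rnorm (w - p ** w + k *: (m ** w)) = rnorm w.
Proof.
move=> kc kk sp sm pm; set u := _ + _.
suff uu : star u ** u = star w ** w.
  apply/eqP; rewrite -(@eqrXn2 _ 2) ?rnorm_ge0//.
  by rewrite -!rnorm_starM uu.
have -> : star u = star w - star w ** p - k *: (star w ** m).
  by rewrite /u starD starB starZ !starM sp sm kc scaleNr.
apply: (@inU_inj _ _ AC); have := congr1 (inU AC) pm.
have := congr1 (@scU _ _ AC) kk; rewrite /u !inUE.
set W := inU _ (star w); set P := inU _ p; set M := inU _ m; set K := scU _ k.
move=> KK PM.
have -> : (W - W * P - K * (W * M)) * (inU AC w - P * inU AC w +
    K * (M * inU AC w)) =
  W * inU AC w * (1 + (P * P + M * M - (P + P)) - (K * K + 1) * (M * M)).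
  ring.
by rewrite KK PM subrr addr0 addNr mul0r subr0 mulr1.
Qed.

(** Here [m] is half the difference, up to the factor [i], of the two
    rotations [1 - p + i m] and [1 - p - i m], so that multiplication by [m]
    does not increase norms; apply this to [m] itself. *)
Lemma sine_le1 p m : star p = p -> star m = m ->
  p ** p + m ** m = p + p -> rnorm m <= 1.
Proof.
move=> sp sm pm; pose k : R[i] := 0 +i* 1.
have kc : (k^*)%R = - k by apply/eqP; rewrite eq_complex /= oppr0 !eqxx.
have kk : k * k = -1.
  by apply/eqP; rewrite eq_complex /= !mul0r !mul1r addr0 sub0r oppr0 !eqxx.
have km : rnorm (k *: (m ** m)) = rnorm m ^+ 2.
  by rewrite rnormZ normc_def /= expr0n expr1n add0r sqrtr1 mul1r rnorm_sqr.
have up := rotation_isometry m kc kk sp sm pm.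
have dn : rnorm (m - p ** m - k *: (m ** m)) = rnorm m.
  rewrite -scaleNr; apply: rotation_isometry => //.
    by rewrite rmorphN /= kc.
  by rewrite mulrNN.
have := rnormD (m - p ** m + k *: (m ** m)) (- (m - p ** m - k *: (m ** m))).
rewrite rnormN up dn opprB [_ + k *: _]addrC addrACA subrr addr0.
rewrite rnorm_double km.
by have := rnorm_ge0 m; nra.
Qed.

(** The conclusion says that [1 - y] is the absolute value of [1 - t], that is
    the square root of [(1 - t) ^ 2 = 1 - (2 t - t ^ 2)].  To take it one needs
    [2 t - t ^ 2] to be the square of a contraction [m].  With [v] as a sine and
    [1 - y1], the root of [1 - v ^ 2], as the cosine, [m = 2 v (1 - y1)] is the
    sine of the doubled angle, whose cosine is [1 - t]. *)
Lemma absolute_value v : star v = v -> rnorm v <= 1 ->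
  let t := v ** v + v ** v in
  exists2 y, rnorm y <= 1 & y ** y - (y + y) = t ** t - (t + t).
Proof.
move=> sv v1 t.
have [y1 [sy1 _ y1E]] : exists y, [/\ star y = y, rnorm y <= 1 &
    y + y = v ** v + y ** y].
  apply: square_root => //; first by rewrite starM sv.
  by rewrite rnorm_sqr// exprn_ile1 ?rnorm_ge0.
pose m := v - v ** y1 + (v - v ** y1).
have sm : star m = m by rewrite starD starB starM sv sy1 AC.
have st : star t = t by rewrite starD starM sv.
have tm : t ** t + m ** m = t + t.
  apply: (@inU_inj _ _ AC); have := congr1 (inU AC) y1E; rewrite /t /m !inUE.
  set V := inU AC v; set Y := inU AC y1 => Y2.
  rewrite [LHS](_ : _ = 4%:R * V * V * (1 + V * V + Y * Y - (Y + Y)));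
    last by ring.
  by rewrite Y2; ring.
have m1 := sine_le1 st sm tm.
have [y [_ y_le1 yE]] : exists y, [/\ star y = y, rnorm y <= 1 &
    y + y = m ** m + y ** y].
  apply: square_root => //; first by rewrite starM sm.
  by rewrite rnorm_sqr// exprn_ile1 ?rnorm_ge0.
exists y => //; rewrite yE -tm; apply: (@inU_inj _ _ AC); rewrite !inUE; ring.
Qed.

End cutoff.

(** * A subalgebra meeting an ideal trivially *)

Section separation.
Context {R : realType} {A : cstarType R}.
Implicit Types (x y : A) (B I : subCStar A).

Lemma subCStarN B x : subCStar_set B x -> subCStar_set B (- x).
Proof. by rewrite -scaleN1r; exact: subCStarZ. Qed.

Lemma subCStarB B x y :
  subCStar_set B x -> subCStar_set B y -> subCStar_set B (x - y).
Proof. by move=> Bx By; apply: subCStarD => //; exact: subCStarN. Qed.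

(** The hypothesis makes the distance [D] from [e] to [I] satisfy
    [D <= q * D]. *)
Lemma closed_contraction (I : set A) (e : A) (q : R) : closed I -> I !=set0 ->
  0 <= q < 1 ->
  (forall g, I g -> exists2 g', I g' & rnorm (e - g') <= q * rnorm (e - g)) ->
  I e.
Proof.
move=> cI [g0 Ig0] /andP[q0 q1] Ie.
pose E := [set rnorm (e - g) | g in I].
have E_inf : has_inf E.
  split; first by exists (rnorm (e - g0)), g0.
  by exists 0 => _ [g _ <-]; exact: rnorm_ge0.
have ED : inf E <= q * inf E.
  apply/ler_addgt0Pr => a a0; have [_ [g Ig <-] ga] := inf_adherent a0 E_inf.
  have [g' Ig' gg'] := Ie _ Ig.
  have : inf E <= rnorm (e - g') by apply: (ge_inf E_inf.2); exists g'.
  by have := rnorm_ge0 (e - g); nra.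
apply: (closed_rnorm cI) => a a0.
have [_ [g Ig <-] ga] := inf_adherent a0 E_inf.
by exists g => //; nra.
Qed.

Hypothesis AC : commutative (@amul _ A).

Lemma absolute_value_in B v : subCStar_set B v -> star v = v -> rnorm v <= 1 ->
  let t := v ** v + v ** v in
  exists y, [/\ subCStar_set B y, rnorm y <= 1 &
    y ** y - (y + y) = t ** t - (t + t)].
Proof.
move=> Bv sv v1 t; pose w : B := SubCStarElt (asboolT Bv).
have BC : commutative (@amul _ B) by move=> a b; apply: val_inj; exact: AC.
have [|y y1 yE] := @absolute_value _ B BC w _ v1; first exact: val_inj.
by exists (cval y); split=> //; [exact: cval_set|exact: (congr1 val yE)].
Qed.

(** If [1 - y] is the absolute value of [1 - x], then [x - y] is twice the
    positive part of [x - 1], and [1 - y] and [x - 1] agree on its support. *)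
Lemma cutoff_eq x y : y ** y - (y + y) = x ** x - (x + x) ->
  x ** (x - y) = (x - y) + (x - y) - y ** (x - y).
Proof.
move=> /(congr1 (inU AC)) E; apply: (@inU_inj _ _ AC); move: E; rewrite !inUE.
move: (inU AC x) (inU AC y) => X Y E; apply/eqP; rewrite -subr_eq0.
rewrite [X in X == 0](_ : _ = X * X - (X + X) - (Y * Y - (Y + Y)));
  last by ring.
by rewrite E subrr.
Qed.

(** If [b + g] had norm less than [1], put [c = (b^* b) ^ 2], of norm [1], and
    let [h] be the same expression in [b + g], of norm [r < 1] and congruent to
    [c] modulo [I].  Let [e] be the cutoff of [c] above a level [s] with
    [r < s < 1].  Modulo [I], multiplication by [c] is multiplication by [h],
    hence shrinks [e] by the factor [r], while [c] is at least [s] where [e]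
    lives; so [e] lies in [I], and in [B], hence vanishes.  This says that
    [c] is bounded by [s], against [c] having norm [1]. *)
Lemma separation_unit B I :
  (forall b g, subCStar_set B b -> subCStar_set I g ->
    subCStar_set I (b ** g)) ->
  (forall b, subCStar_set B b -> subCStar_set I b -> b = 0) ->
  forall b g, subCStar_set B b -> subCStar_set I g -> rnorm b = 1 ->
    1 <= rnorm (b + g).
Proof.
move=> BI BI0 b g Bb Ig b1; rewrite leNgt; apply/negP => bg1.
pose d := star b ** b; pose f := star (b + g) ** (b + g).
pose c := d ** d; pose h := f ** f.
have sd : star d = d by rewrite starM starK.
have sf : star f = f by rewrite starM starK.
have Bd : subCStar_set B d by apply: subCStarM => //; exact: subCStar_star.
have d1 : rnorm d = 1 by rewrite rnorm_starM b1 expr1n.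
have Ih : subCStar_set I (h - c).
  pose k := (star b ** g + b ** star g) + star g ** g.
  have Ik : subCStar_set I k.
    apply: subCStarD; last by apply: subCStarM => //; exact: subCStar_star.
    by apply: subCStarD; apply: BI => //; exact: subCStar_star.
  have -> : h - c = d ** k + d ** k + k ** k.
    apply: (@inU_inj _ _ AC).
    by rewrite /h /c /f /d /k starD !inUE; ring.
  by apply: subCStarD; [apply: subCStarD|apply: subCStarM] => //; exact: BI.
pose r := rnorm h.
have r0 : 0 <= r by exact: rnorm_ge0.
have r1 : r < 1.
  rewrite /r rnorm_sqr// rnorm_starM -exprM exprn_ilt1 ?rnorm_ge0//.
(* The level [s] lies strictly between [r] and [1], and is at least [1 / 2]:
   this makes [v] below a contraction with [2 v ^ 2 = c / s]. *)
pose s := (1 + r) / 2.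
pose kap := Num.sqrt (s^-1 / 2).
have s0 : 0 < s by rewrite /s; lra.
have s1 : s < 1 by rewrite /s; lra.
have rs : r < s by rewrite /s; lra.
have s2 : s^-1 <= 2 by rewrite -[leRHS]invrK lef_pV2 ?posrE//; rewrite /s; lra.
have s_gt1 : 1 < s^-1 by rewrite invf_gt1.
have kap2 : kap * kap = s^-1 / 2 by rewrite -expr2 sqr_sqrtr//; lra.
pose v := kap%:C *: d; pose t := v ** v + v ** v.
have Bv : subCStar_set B v by exact: subCStarZ.
have sv : star v = v by rewrite starZr sd.
have v1 : rnorm v <= 1.
  rewrite rnormZr d1 mulr1 ger0_norm ?sqrtr_ge0//.
  rewrite -sqrtr1 ler_wsqrtr//; lra.
have tE : t = s^-1%:C *: c.
  rewrite /t /v scale_amull scale_amulr scalerA -rmorphM /= kap2 -scalerDl.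
  by rewrite -rmorphD /= -splitr.
have [y [By y1 yE]] := absolute_value_in Bv sv v1.
pose e := t - y.
have Bt : subCStar_set B t by apply: subCStarD; exact: subCStarM.
have Be : subCStar_set B e by exact: subCStarB.
have te : t ** e = e + e - y ** e by exact: cutoff_eq yE.
have Ie : subCStar_set I e.
  apply: (@closed_contraction _ _ ((1 + r / s) / 2)).
  - exact: subCStar_closed.
  - by exists 0; exact: subCStar0.
  - have : r / s < 1 by rewrite ltr_pdivrMr// mul1r.
    have : 0 <= r / s by rewrite divr_ge0// ltW.
    lra.
  move=> g1 Ig1.
  (* From [t e = 2 e - y e] one gets [e = (t e + y e) / 2]; an approximation of
     [e] in [I] is improved by substituting it in the right-hand side, where
     [t e = c e / s] is replaced with [h e / s] modulo [I]. *)
  pose G := s^-1%:C *: (h ** g1 - (h - c) ** e).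
  have Ihg1 : subCStar_set I (h ** g1).
    rewrite -(subrK c h) amulDl; apply: subCStarD; first exact: subCStarM.
    by apply: BI => //; exact: subCStarM.
  exists ((2^-1)%:C *: (G + y ** g1)).
    apply: subCStarZ; apply: subCStarD; last exact: BI.
    by apply: subCStarZ; apply: subCStarB => //; rewrite AC; exact: BI.
  have -> : e - (2^-1)%:C *: (G + y ** g1) =
      (2^-1)%:C *: (s^-1%:C *: (h ** (e - g1)) + y ** (e - g1)).
    have eE : e = (2^-1)%:C *: (s^-1%:C *: (c ** e) + y ** e).
      by rewrite -scale_amull -tE te subrK scale_half_double.
    rewrite {1}eE -scalerBr; congr (_ *: _); apply: (@inU_inj _ _ AC).
    by rewrite /G !inUE; ring.
  rewrite rnormZr ger0_norm; last by lra.
  rewrite mulrAC [leRHS]mulrC ler_wpM2l//; first by lra.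
  rewrite (le_trans (rnormD _ _))// addrC mulrDl mul1r lerD//.
    rewrite (le_trans (rnormM _ _))//.
    by rewrite ler_piMl ?rnorm_ge0.
  rewrite rnormZr ger0_norm; last by lra.
  rewrite [r / s]mulrC -mulrA ler_wpM2l//; first by lra.
  exact: rnormM.
have ty : t = y by apply/eqP; rewrite -subr_eq0; apply/eqP/BI0.
have : rnorm t = s^-1.
  rewrite tE rnormZr ger0_norm; last by lra.
  by rewrite rnorm_sqr// d1 expr1n mulr1.
rewrite ty; lra.
Qed.

End separation.

Section closed_sums.
Context {R : realType} {A : cstarType R}.
Implicit Types (x y : A) (B I : subCStar A).

(** In the quotient by [I] this says that the injective homomorphism induced
    on [B] is isometric. *)
Lemma separation (AC : commutative (@amul _ A)) B I :
  (forall b g, subCStar_set B b -> subCStar_set I g ->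
    subCStar_set I (b ** g)) ->
  (forall b, subCStar_set B b -> subCStar_set I b -> b = 0) ->
  forall b g, subCStar_set B b -> subCStar_set I g -> rnorm b <= rnorm (b + g).
Proof.
move=> BI BI0 b g Bb Ig.
have [b0|b0] := eqVneq (rnorm b) 0; first by rewrite b0 rnorm_ge0.
have b_gt0 : 0 < rnorm b by rewrite lt_def b0 rnorm_ge0.
have bV : `|(rnorm b)^-1| = (rnorm b)^-1 by rewrite ger0_norm// invr_ge0 ltW.
have := separation_unit AC BI BI0 (subCStarZ (rnorm b)^-1%:C Bb)
  (subCStarZ (rnorm b)^-1%:C Ig).
rewrite -scalerDr !rnormZr bV mulVf// => /(_ erefl).
by rewrite mulrC ler_pdivlMr// mul1r.
Qed.

(** The bound makes the [X]-parts of a convergent sequence of sums a Cauchy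
    sequence. *)
Lemma closed_sum (X Y : set A) :
  closed X -> closed Y ->
  (forall b b', X b -> X b' -> X (b - b')) ->
  (forall g g', Y g -> Y g' -> Y (g - g')) ->
  (forall b g, X b -> Y g -> rnorm b <= rnorm (b + g)) ->
  closed [set z | exists b g, [/\ X b, Y g & z = b + g]].
Proof.
move=> cX cY XB YB XY z /closure_rnormP zXY.
have n0 (n : nat) : 0 < (n.+1%:R : R)^-1 by rewrite invr_gt0.
have /choice[p pP] : forall n : nat, exists p : A * A,
    [/\ X p.1, Y p.2 & rnorm (z - (p.1 + p.2)) < n.+1%:R^-1].
  by move=> n; have [_ [b [g [Xb Yg ->]]] bg] := zXY _ (n0 n); exists (b, g).
have nsmall (e : R) : 0 < e -> exists N, forall n, (N <= n)%N -> n.+1%:R^-1 < e.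
  move=> e0; exists (Num.truncn e^-1) => n.
  by rewrite invf_plt ?posrE// -truncn_le_nat.
have [b bP] : exists l, forall e : R, 0 < e ->
    exists N, forall n, (N <= n)%N -> rnorm (l - (p n).1) < e.
  apply: cauchy_limit => e e0; have e2 : 0 < e / 2 by lra.
  have [N NP] := nsmall _ e2; exists N => n Nn.
  have [Xn Yn zn] := pP n; have [XN YN zN] := pP N.
  rewrite (le_lt_trans (XY _ _ (XB _ _ Xn XN) (YB _ _ Yn YN)))//.
  rewrite addrACA -opprD (le_lt_trans (rnorm_dist _ z _))// rnormB.
  rewrite [e]splitr ltrD//; [apply: lt_trans zn _|apply: lt_trans zN _];
    exact: NP.
exists b, (z - b); rewrite subrKC; split=> //.
  apply: (closed_rnorm cX) => e /bP[N /(_ N (leqnn N)) bN].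
  by exists (p N).1 => //; case: (pP N).
apply: (closed_rnorm cY) => e e0; have e2 : 0 < e / 2 by lra.
have [N bN] := bP _ e2; have [M zM] := nsmall _ e2.
have {}bN := bN _ (leq_maxl N M); have {}zM := zM _ (leq_maxr N M).
have [_ Yp zp] := pP (maxn N M); exists (p (maxn N M)).2 => //.
move: (p _) Yp zp bN => q Yq zq bN.
have -> : z - b - q.2 = (z - (q.1 + q.2)) - (b - q.1).
  by rewrite opprB [q.1 + q.2]addrC opprD (addrA z) subrKA addrAC.
rewrite (le_lt_trans (rnormD _ _))// rnormN [e]splitr ltrD//.
exact: lt_trans zq zM.
Qed.

End closed_sums.

Section closed_spans.
Context {R : realType} {A : cstarType R}.
Implicit Types (X Y : set A) (S : subCStar A).

Lemma closed_spanM X Y S :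
  (forall x y, X x -> Y y -> subCStar_set S (x ** y)) ->
  forall x y, closed_span X x -> closed_span Y y -> subCStar_set S (x ** y).
Proof.
move=> XYS x y Xx Yy; have cS := @subCStar_closed _ _ S.
apply: (closure_stable (@amul_continuousr _ _ y) cS _ Xx).
apply: cspan_ind => [|u v|k u Xu].
- by rewrite mul0a; exact: subCStar0.
- by rewrite amulDl; exact: subCStarD.
rewrite scale_amull; apply: subCStarZ.
apply: (closure_stable (@amul_continuous _ _ u) cS _ Yy).
apply: cspan_ind => [|v w|l v Yv].
- by rewrite amul0; exact: subCStar0.
- by rewrite amulDr; exact: subCStarD.
by rewrite scale_amulr; apply: subCStarZ; exact: XYS.
Qed.

End closed_spans.

(** * Components of a graded algebra *)

Section graded_components.
Context {R : realType} {d : Order.disp_t} {L : meetSemilatticeType d}.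
Context {A : cstarType R} (A_ : L -> subCStar A).
Hypothesis gA : graded A_.
Implicit Types (F G : set L) (x y : A) (i j k : L).

Definition components F : set A := \bigcup_(j in F) subCStar_set (A_ j).

Definition meet_stable F := forall j k, F j -> F k -> F (j `&` k)%O.

Lemma components_star F x : components F x -> components F (star x).
Proof. by move=> [j Fj jx]; exists j => //; exact: subCStar_star. Qed.

Lemma componentsM F x y : meet_stable F ->
  components F x -> components F y -> components F (x ** y).
Proof.
move=> FM [j Fj jx] [k Fk ky]; exists (j `&` k)%O; first exact: FM.
exact: gradedM.
Qed.

Definition component_alg F (FM : meet_stable F) : subCStar A :=
  closed_span_subCStar (fun x y => @componentsM F x y FM) (@components_star F).

Lemma fsum_widen (u : L -> A) (D : set L) :
  [set j | u j != 0] `<=` D ->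
  \sum_(j \in [set: L]) u j = \sum_(j \in D) u j.
Proof.
move=> uD; apply/esym/fsbig_widen => // j [_ /= Dj].
by apply/eqP; apply: contrapT => /negP /uD.
Qed.

Lemma cspan_components_sum F x : cspan (components F) x ->
  exists u : L -> A, [/\ forall j, subCStar_set (A_ j) (u j),
    forall j, u j != 0 -> F j, finite_set [set j | u j != 0] &
    x = \sum_(j \in [set: L]) u j].
Proof.
move: x; apply: cspan_ind.
- exists (fun=> 0); split=> [j|j||]; rewrite ?eqxx//; first exact: subCStar0.
    by apply: (sub_finite_set _ (@finite_set0 L)).
  by rewrite fsbig1.
- move=> _ _ [u [uA uF uf ->]] [v [vA vF vf ->]].
  pose D := [set j | u j != 0] `|` [set j | v j != 0].
  have uvD : [set j | u j + v j != 0] `<=` D.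
    move=> j /=; have [uj|uj _] := eqVneq (u j) 0; last by left.
    by rewrite uj add0r; right.
  have fD : finite_set D by rewrite finite_setU.
  exists (fun j => u j + v j); split=> [j|j /uvD[/uF|/vF]//||].
  + exact: subCStarD.
  + exact: sub_finite_set uvD fD.
  + rewrite (fsum_widen uvD) (@fsum_widen u D); last by move=> j; left.
    by rewrite (@fsum_widen v D) ?fsbig_split// => j; right.
- move=> k x [j Fj jx].
  pose u i := if i == j then k *: x else 0.
  have uj : [set i | u i != 0] `<=` [set j].
    by move=> i /=; rewrite /u; case: (eqVneq i j) => // _; rewrite eqxx.
  exists u; split=> [i|i /uj -> //||].
  + rewrite /u; case: (eqVneq i j) => [->|_]; last exact: subCStar0.
    exact: subCStarZ.
  + exact: sub_finite_set uj (finite_set1 j).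
  + by rewrite (fsum_widen uj) fsbig_set1 /u eqxx.
Qed.

(** Linear independence of the components, in terms of spans. *)
Lemma cspan_components_free F G x : F `&` G = set0 ->
  cspan (components F) x -> cspan (components G) x -> x = 0.
Proof.
move=> FG0 Fx Gx.
have [u [uA uF uf xu]] := cspan_components_sum Fx.
have [v [vA vG vf xv]] := cspan_components_sum (cspanZ (-1) Gx).
pose D := [set j | u j != 0] `|` [set j | v j != 0].
have uvD : [set j | u j + v j != 0] `<=` D.
  move=> j /=; have [uj|uj _] := eqVneq (u j) 0; last by left.
  by rewrite uj add0r; right.
have fD : finite_set D by rewrite finite_setU.
have uv0 : \sum_(j \in [set: L]) (u j + v j) = 0.
  rewrite (fsum_widen uvD) fsbig_split//.
  rewrite -(@fsum_widen u D); last by move=> j; left.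
  rewrite -(@fsum_widen v D); last by move=> j; right.
  by rewrite -xu -xv scaleN1r /= subrr.
have uv j : u j + v j = 0.
  apply: (graded_free gA _ _ uv0); last exact: sub_finite_set uvD fD.
  by move=> i; exact: subCStarD.
rewrite xu fsbig1// => j _; apply/eqP; apply: contrapT => /negP uj.
have vj : v j != 0.
  by apply: contra_neqN uj => /eqP vj; rewrite -[u j]addr0 -vj uv.
have : (F `&` G) j by split; [exact: uF|exact: vG].
by rewrite FG0.
Qed.

End graded_components.

(** * Norm estimates on spans of components *)

Section graded_projections.
Context {R : realType} {d : Order.disp_t} {L : meetSemilatticeType d}.
Context {A : cstarType R} (A_ : L -> subCStar A).
Hypothesis gA : graded A_.
Hypothesis AC : commutative (@amul _ A).
Implicit Types (F G : set L) (x y : A) (i j k : L) (s t : seq L).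
Local Notation components := (components A_).

Lemma cspan_mono (X Y : set A) : X `<=` Y -> cspan X `<=` cspan Y.
Proof.
move=> XY; apply: cspan_ind; first exact: cspan0.
  by move=> x y; exact: cspanD.
by move=> k x /XY/sub_cspan; exact: cspanZ.
Qed.

Lemma components_sub F G : F `<=` G -> components F `<=` components G.
Proof. by move=> FG x [j /FG Gj jx]; exists j. Qed.

Lemma component_algM F G (GM : meet_stable G) :
  (forall j k, F j -> G k -> G (j `&` k)%O) ->
  forall b g, closed_span (components F) b -> closed_span (components G) g ->
    subCStar_set (component_alg gA GM) (b ** g).
Proof.
move=> FG; apply: closed_spanM => x y [j Fj jx] [k Gk ky].
apply/subset_closure/sub_cspan; exists (j `&` k)%O; first exact: FG.
exact: gradedM.
Qed.

Lemma exists_maximal s : s != [::] ->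
  exists2 k, k \in s & forall j, j \in s -> (k <= j)%O -> j = k.
Proof.
elim: s => // a [|b s] IH _.
  by exists a => [|j]; rewrite inE => // /eqP.
have [//|k ks kmax] := IH; have [ka|ka] := boolP (k <= a)%O; last first.
  exists k => [|j]; first by rewrite inE ks orbT.
  by rewrite inE => /predU1P[->|/kmax//]; rewrite (negPf ka).
exists a => [|j]; first by rewrite inE eqxx.
rewrite inE => /predU1P[->//|js aj].
have jk := kmax _ js (le_trans ka aj).
by apply: le_anti; rewrite aj jk ka.
Qed.

Lemma meet_stable_filter (P : pred L) s : meet_stable [set` s] ->
  (forall j k, P j -> P k -> P (j `&` k)%O) ->
  meet_stable [set` [seq j <- s | P j]].
Proof.
move=> sM PM j k /=; rewrite !mem_filter => /andP[Pj js] /andP[Pk ks].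
by rewrite PM//=; exact: sM.
Qed.

(** Induction on the number of indices.  Let [k] be maximal in [s]: it is the
    meet of two indices of [s] only when both are [k], so that the components
    over the other indices span an ideal, closed by induction and meeting
    [A_ k] trivially.  The sum of this ideal and [A_ k] is then closed. *)
Lemma closed_span_finite s : meet_stable [set` s] ->
  closed_span (components [set` s]) = cspan (components [set` s]).
Proof.
suff H n : forall s, (size s <= n)%N -> meet_stable [set` s] ->
    closed (cspan (components [set` s])).
  by move=> sM; apply/esym/closure_id; exact: (H (size s)).
elim: n => [|n IH] {}s.
  rewrite leqn0 size_eq0 => /eqP -> _.
  rewrite (_ : cspan _ = [set 0]).
    exact/accessible_closed_set1/hausdorff_accessible/norm_hausdorff.
  apply/seteqP; split=> [|_ ->]; last exact: cspan0.
  apply: cspan_ind => // [x y /= -> ->|k x [j]//]; exact: addr0.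
have [->|s0] := eqVneq s [::]; first by move=> _; exact: IH.
move=> sn sM; have [k ks kmax] := exists_maximal s0.
pose s' := [seq j <- s | j != k].
have sk j : j \in s' -> (k `&` j)%O \in s'.
  rewrite !mem_filter => /andP[jk js]; rewrite (sM k j)//= andbT.
  by apply: contra jk => /eqP kj; rewrite (kmax j)// -kj leIr.
have s'M : meet_stable [set` s'].
  move=> j j' /=; rewrite !mem_filter => /andP[jk js] /andP[_ js'].
  rewrite (sM j j')//= andbT; apply: contra jk => /eqP jj'.
  by rewrite (kmax j)// -jj' leIl.
have s'n : (size s' <= n)%N.
  rewrite -ltnS (leq_trans _ sn)// size_filter -(count_predC (pred1 k) s).
  by rewrite -[ltnLHS]add0n ltn_add2r -has_count has_pred1.
have s'cl : closed (cspan (components [set` s'])) by exact: IH.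
have s'E : closed_span (components [set` s']) = cspan (components [set` s']).
  exact/esym/closure_id.
have subk : subCStar_set (A_ k) `<=` cspan (components [set k]).
  by move=> x kx; apply: sub_cspan; exists k.
have sep b g : subCStar_set (A_ k) b -> cspan (components [set` s']) g ->
    rnorm b <= rnorm (b + g).
  rewrite -s'E => kb s'g.
  apply: (@separation _ _ AC (A_ k) (component_alg gA s'M)) => //.
    move=> {kb s'g}b {}g kb.
    apply: (@component_algM [set k]) => [j j' -> /sk//|].
    exact/subset_closure/subk.
  move=> {kb s'g g}b kb; rewrite /= s'E => s'b.
  apply: (cspan_components_free gA _ (subk _ kb) s'b).
  by rewrite -subset0 => j [/= ->]; rewrite mem_filter eqxx.
rewrite (_ : cspan _ = [set z | exists b g, [/\ subCStar_set (A_ k) b,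
    cspan (components [set` s']) g & z = b + g]]).
  apply: closed_sum => //; [exact: subCStar_closed|exact: subCStarB|].
  by move=> g g' Yg Yg'; rewrite -scaleN1r; apply: cspanD => //; exact: cspanZ.
apply/seteqP; split=> [|_ [b [g [kb s'g ->]]]].
  apply: cspan_ind.
  - by exists 0, 0; split; [exact: subCStar0|exact: cspan0|rewrite addr0].
  - move=> _ _ [b [g [kb sg ->]]] [b' [g' [kb' sg' ->]]].
    exists (b + b'), (g + g'); split; [exact: subCStarD|exact: cspanD|].
    by rewrite addrACA.
  - move=> l x [j js jx]; have [jk|jk] := eqVneq j k.
      exists (l *: x), 0; split; [|exact: cspan0|by rewrite addr0].
      by apply: subCStarZ; rewrite -jk.
    exists 0, (l *: x); split; [exact: subCStar0| |by rewrite add0r].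
    by apply/cspanZ/sub_cspan; exists j => //=; rewrite mem_filter jk.
apply: cspanD; first by apply: sub_cspan; exists k.
apply: cspan_mono s'g; apply: components_sub => j /=.
by rewrite mem_filter => /andP[].
Qed.

(** Finitely generated semilattices are finite. *)
Lemma meet_closure s :
  exists2 t : seq L, {subset s <= t} & meet_stable [set` t].
Proof.
elim: s => [|a s [t st tM]]; first by exists [::].
exists (a :: t ++ [seq (a `&` j)%O | j <- t]).
  by move=> j; rewrite !inE mem_cat => /predU1P[->|/st ->]; rewrite ?eqxx ?orbT.
suff H j k : j \in a :: t ++ [seq (a `&` j)%O | j <- t] ->
    k \in a :: t ++ [seq (a `&` j)%O | j <- t] ->
    [\/ (j `&` k)%O = a, (j `&` k)%O \in t |
      exists2 l, l \in t & (j `&` k)%O = (a `&` l)%O].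
  move=> j k js ks /=; rewrite inE mem_cat.
  have [->|->|[l lt ->]] := H j k js ks; rewrite ?eqxx ?orbT//.
  by rewrite map_f ?orbT.
rewrite !inE !mem_cat.
move=> /predU1P[->|/orP[jt|/mapP[j' jt ->]]]
  /predU1P[->|/orP[kt|/mapP[k' kt ->]]].
- by apply: Or31; rewrite meetxx.
- by apply: Or33; exists k.
- by apply: Or33; exists k' => //; rewrite meetA meetxx.
- by apply: Or33; exists j => //; rewrite meetC.
- by apply: Or32; exact: tM.
- by apply: Or33; exists (j `&` k')%O; [exact: tM|rewrite meetCA].
- by apply: Or33; exists j' => //; rewrite meetAC meetxx.
- by apply: Or33; exists (j' `&` k)%O; [exact: tM|rewrite meetA].
- by apply: Or33; exists (j' `&` k')%O; [exact: tM|rewrite meetACA meetxx].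
Qed.

Lemma cspan_components_finite F x : cspan (components F) x ->
  exists s : seq L, cspan (components (F `&` [set` s])) x.
Proof.
move: x; apply: cspan_ind => [|x y [s sx] [t ty]|k x [j Fj jx]].
- by exists [::]; exact: cspan0.
- exists (s ++ t); apply: cspanD; [apply: cspan_mono sx|apply: cspan_mono ty];
    apply: components_sub => j [Fj /= js];
    by split; rewrite //= mem_cat js ?orbT.
- exists [:: j]; apply/cspanZ/sub_cspan; exists j => //; split=> //=.
  by rewrite mem_head.
Qed.

(** Two elements of the spans involve finitely many indices, hence live over a
    finite meet-stable set.  There the spans are complete and, by linear
    independence, meet trivially. *)
Lemma separation_cspan F G : meet_stable F -> meet_stable G ->
  (forall j k, F j -> G k -> G (j `&` k)%O) -> F `&` G = set0 ->
  forall b g, cspan (components F) b -> cspan (components G) g ->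
    rnorm b <= rnorm (b + g).
Proof.
move=> FM GM FGM FG0 b g /cspan_components_finite[s1 bs1].
move=> /cspan_components_finite[s2 gs2].
have [s ss sM] := meet_closure (s1 ++ s2).
pose sF := [seq j <- s | `[< F j >]]; pose sG := [seq j <- s | `[< G j >]].
have sFM : meet_stable [set` sF].
  apply: meet_stable_filter => // j k /asboolP Fj /asboolP Fk.
  exact/asboolP/FM.
have sGM : meet_stable [set` sG].
  apply: meet_stable_filter => // j k /asboolP Gj /asboolP Gk.
  exact/asboolP/GM.
apply: (@separation _ _ AC (component_alg gA sFM) (component_alg gA sGM)).
- move=> {bs1}b {gs2}g; apply: component_algM => j k /=.
  rewrite !mem_filter => /andP[/asboolP Fj js] /andP[/asboolP Gk ks].
  by rewrite (sM j k)//= andbT; apply/asboolP; exact: FGM.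
- move=> {bs1}b /=; rewrite !closed_span_finite//.
  apply: cspan_components_free => //; rewrite -subset0 -FG0 => j /=.
  by rewrite !mem_filter => -[/andP[/asboolP ? _] /andP[/asboolP]].
- apply: subset_closure; apply: cspan_mono bs1.
  apply: components_sub => j [Fj /= js]; rewrite mem_filter.
  by rewrite ss ?mem_cat ?js// andbT; exact/asboolP.
- apply: subset_closure; apply: cspan_mono gs2.
  apply: components_sub => j [Gj /= js]; rewrite mem_filter.
  by rewrite ss ?mem_cat ?js ?orbT// andbT; exact/asboolP.
Qed.

End graded_projections.

(** * The projections onto the upper subalgebras *)

Lemma rnorm_lipschitz_continuous (R : realType) (V W : normedModType R[i])
    (f : V -> W) (M : R) :
  (forall x y, rnorm (f x - f y) <= M * rnorm (x - y)) -> continuous f.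
Proof.
move=> fM x; apply/cvgrPdist_lt => eps /complex_gt0[-> e0].
pose e := complex.Re eps.
have M0 : 0 < Num.max M 0 + 1 by rewrite ltr_wpDl// le_max lexx orbT.
have eM : 0 < (e / (Num.max M 0 + 1))%:C :> R[i] by rewrite ltcR divr_gt0.
near=> y; rewrite -rnorm_ltP (le_lt_trans (fM _ _))//.
have : rnorm (x - y) < e / (Num.max M 0 + 1).
  by rewrite rnorm_ltP; near: y; exact: cvgr_dist_lt.
rewrite ltr_pdivlMr// => xy; rewrite mulrC; apply: le_lt_trans xy.
by rewrite ler_wpM2l ?rnorm_ge0// ler_wpDr// le_max lexx.
Unshelve. all: by end_near. Qed.

Lemma dense_rnorm (R : realType) (A : cstarType R) (D : set A) (x : A)
    (e : R) : dense D -> 0 < e ->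
  exists2 y, D y & rnorm (x - y) < e.
Proof.
move=> dD e0; have e0' : 0 < e%:C :> R[i] by rewrite ltcR.
have [|y []] := dD (ball x e%:C) _ (ball_open x _).
  by exists x; exact: ballxx.
by rewrite -ball_normE /= -rnorm_ltP => xy Dy; exists y.
Qed.

Section projections.
Context {R : realType} {d : Order.disp_t} {L : meetSemilatticeType d}.
Context {A : cstarType R} (A_ : L -> subCStar A).
Hypothesis gA : graded A_.
Hypothesis AC : commutative (@amul _ A).
Implicit Types (x y : A) (i j k : L).

(** The components over these indices span an ideal, because an index below one
    that is not above [i] is not above [i]; it becomes the kernel of the
    projection. *)
Definition not_above i : set L := [set j | ~~ (i <= j)%O].

Lemma above_stable i : meet_stable [set j | (i <= j)%O].
Proof. by move=> j k /= ij ik; rewrite lexI ij. Qed.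

Lemma not_above_meet i j k : not_above i k -> not_above i (j `&` k)%O.
Proof. by apply: contra => /le_trans; apply; exact: leIr. Qed.

Lemma not_above_stable i : meet_stable (not_above i).
Proof. by move=> j k _; exact: not_above_meet. Qed.

Definition complement_alg i : subCStar A :=
  component_alg gA (@not_above_stable i).

Lemma separation_above i b g : subCStar_set (above gA i) b ->
  subCStar_set (complement_alg i) g -> rnorm b <= rnorm (b + g).
Proof.
move=> /closure_rnormP ib /closure_rnormP ig; apply/ler_addgt0Pr => e e0.
have e3 : 0 < e / 3 by lra.
have [b' ib' bb'] := ib _ e3; have [g' ig' gg'] := ig _ e3.
have : rnorm b' <= rnorm (b' + g').
  apply: (separation_cspan gA AC (@above_stable i) (@not_above_stable i))
    ib' ig'.
    by move=> j k _; exact: not_above_meet.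
  by rewrite -subset0 => j [/= ij]; rewrite /not_above /= ij.
have := rnormD b' (b - b'); rewrite subrKC.
have := rnormD (b + g) (- (b - b' + (g - g'))); rewrite rnormN.
rewrite addrACA -opprD subKr.
have := rnormD (b - b') (g - g'); rewrite addrACA -opprD; lra.
Qed.

Lemma complement_ideal i b g : subCStar_set (above gA i) b ->
  subCStar_set (complement_alg i) g -> subCStar_set (complement_alg i) (b ** g).
Proof. by apply: component_algM => j k _; exact: not_above_meet. Qed.

Lemma above_complement0 i b : subCStar_set (above gA i) b ->
  subCStar_set (complement_alg i) b -> b = 0.
Proof.
move=> ib ib'; apply: rnorm_eq0; apply: le_anti; rewrite rnorm_ge0 andbT.
have := separation_above ib (subCStarN ib').
by rewrite subrr rnorm0.
Qed.

Lemma above_component i j x :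
  (i <= j)%O -> subCStar_set (A_ j) x -> subCStar_set (above gA i) x.
Proof. by move=> ij jx; apply/subset_closure/sub_cspan; exists j. Qed.

Lemma complement_component i j x :
  ~~ (i <= j)%O -> subCStar_set (A_ j) x -> subCStar_set (complement_alg i) x.
Proof. by move=> ij jx; apply/subset_closure/sub_cspan; exists j. Qed.

(** The sum of the two subalgebras is closed because the norm estimate passes
    from the spans to their closures, and it contains every component. *)
Lemma above_complement_sum i x :
  exists b g, [/\ subCStar_set (above gA i) b,
    subCStar_set (complement_alg i) g & x = b + g].
Proof.
suff: [set z | exists b g, [/\ subCStar_set (above gA i) b,
    subCStar_set (complement_alg i) g & z = b + g]] x by [].
apply: closed_rnorm.
  apply: closed_sum; [exact: subCStar_closed|exact: subCStar_closed| | |].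
  - exact: subCStarB.
  - exact: subCStarB.
  - by move=> b g; exact: separation_above.
move=> e e0; have [y Dy xy] := dense_rnorm x (graded_total gA) e0.
exists y => //; move: y Dy {xy}; apply: cspan_ind.
- by exists 0, 0; split; [exact: subCStar0|exact: subCStar0|rewrite addr0].
- move=> _ _ [b [g [ib ig ->]]] [b' [g' [ib' ig' ->]]].
  exists (b + b'), (g + g'); split; [exact: subCStarD|exact: subCStarD|].
  by rewrite addrACA.
- move=> k y [j _ jy]; have [ij|ij] := boolP (i <= j)%O.
    exists (k *: y), 0; split; [|exact: subCStar0|by rewrite addr0].
    by apply: subCStarZ; exact: above_component jy.
  exists 0, (k *: y); split; [exact: subCStar0| |by rewrite add0r].
  by apply: subCStarZ; exact: complement_component jy.
Qed.

Lemma above_unique i x (b b' : above gA i) :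
  subCStar_set (complement_alg i) (x - cval b) ->
  subCStar_set (complement_alg i) (x - cval b') -> b = b'.
Proof.
move=> xb xb'; apply: val_inj; apply/eqP; rewrite -subr_eq0; apply/eqP.
apply: (@above_complement0 i); first exact: (cval_set (b - b')).
rewrite (_ : _ - _ = (x - cval b') - (x - cval b)); first exact: subCStarB.
by rewrite opprB [RHS]addrC subrKA.
Qed.

(** By directness of the sum, the part of [x] in the upper subalgebra is
    characterized by its congruence to [x] modulo an ideal, which makes it a
    homomorphism; it is contractive by the norm estimate. *)
Lemma exists_proj i : exists p, @is_proj _ _ _ _ _ gA i p.
Proof.
have /choice[p pP] : forall x, exists b : above gA i,
    subCStar_set (complement_alg i) (x - cval b).
  move=> x; have [b [g [ib ig ->]]] := above_complement_sum i x.
  by exists (SubCStarElt (asboolT ib)); rewrite /= [b + g]addrC addrK.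
have pE x (b : above gA i) : subCStar_set (complement_alg i) (x - cval b) ->
    p x = b.
  exact/above_unique/pP.
have pl : linear p.
  move=> k x y; apply: pE.
  rewrite (_ : _ - _ = k *: (x - cval (p x)) + (y - cval (p y))).
    by apply: subCStarD => //; exact: subCStarZ.
  by rewrite /= scalerBr addrACA -opprD.
have pB x y : p (x - y) = p x - p y.
  by rewrite [x - y]addrC -scaleN1r pl scaleN1r addrC.
exists p; split; [split=> //| |].
- move=> x y; apply: pE.
  pose b := cval (p x); pose b' := cval (p y).
  have -> : x ** y - cval (p x ** p y) =
      (x - b) ** (y - b') + b ** (y - b') + b' ** (x - b).
    rewrite [cval (_ ** _)](_ : _ = b ** b')//; move: b b' => b b'.
    by apply: (@inU_inj _ _ AC); rewrite !inUE; ring.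
  apply: subCStarD; [apply: subCStarD; [exact: subCStarM|]|];
    apply: complement_ideal => //; exact: cval_set.
- move=> x; apply: pE.
  have -> : star x - cval (star (p x)) = star (x - cval (p x)) by rewrite starB.
  exact: subCStar_star.
- apply: (@rnorm_lipschitz_continuous _ _ _ p 1) => x y; rewrite -pB mul1r.
  have := separation_above (cval_set (p (x - y))) (pP (x - y)).
  by rewrite subrKC.
- move=> j x ij jx; have ix := above_component ij jx.
  rewrite (pE x (SubCStarElt (asboolT ix)))// [cval _]/= subrr.
  exact: subCStar0.
- move=> j x ij jx; apply: pE; rewrite subr0.
  exact: complement_component jx.
Qed.

Lemma projP i : @is_proj _ _ _ _ _ gA i (Defs.proj gA i).
Proof.
by have [p ip] := exists_proj i; exact: (xgetPex _ (ex_intro _ p ip)).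
Qed.

End projections.

(** * Extending a character to the multiplier algebra *)

Section scalar_maps.
Context {R : realType} {V : normedModType R[i]} {f : V -> R[i]}.
Hypothesis fl : scalar f.

Lemma scalar_map0 : f 0 = 0.
Proof. by have := fl (-1) 0 0; rewrite scaler0 addr0 mulN1r addNr. Qed.

Lemma scalar_mapD x y : f (x + y) = f x + f y.
Proof. by have := fl 1 x y; rewrite scale1r mul1r. Qed.

Lemma scalar_mapZ (k : R[i]) x : f (k *: x) = k * f x.
Proof. by have := fl k x 0; rewrite scalar_map0 !addr0. Qed.

End scalar_maps.

Lemma character_eq1 (R : realType) (A : normedAlgType R[i]) (chi : A -> R[i]) :
  Sp A chi -> exists a, chi a = 1.
Proof.
move=> chiA; have [a a0] := character_neq0 chiA; exists ((chi a)^-1 *: a).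
by rewrite (scalar_mapZ (character_linear chiA)) mulVf.
Qed.

Section extension.
Context {R : realType} {A : cstarType R} {chi : A -> R[i]}.
Hypothesis chiA : Sp A chi.
Implicit Types (m : multiplier A) (a b x : A).

(** The two sides are not separated by left multiplications, and
    [star z ** z = 0] forces [z = 0]. *)
Lemma lmultM m b x : lmult m (b ** x) = lmult m b ** x.
Proof.
have ann c : c ** (lmult m (b ** x) - lmult m b ** x) = 0.
  by rewrite amulBr rmult_lmult !amulA rmult_lmult subrr.
apply/eqP; rewrite -subr_eq0; apply/eqP; apply: rnorm_eq0.
by apply/eqP; rewrite -sqrf_eq0 -rnorm_starM ann rnorm0.
Qed.

Lemma multiplier_mul_to m b : m ** to_multiplier b = to_multiplier (lmult m b).
Proof.
apply: multiplierP => x /=; first exact: lmultM.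
by rewrite rmult_lmult.
Qed.

(** The ratio of [chi (lmult m a)] to [chi a] does not depend on [a], as long
    as [chi a] is not zero; it is the value at [m] of the extended character. *)
Lemma lmult_char m a b :
  chi (lmult m a) * chi b = chi (lmult m b) * chi a.
Proof.
have E c c' : chi c * chi (lmult m c') = chi (rmult m c) * chi c'.
  by rewrite -!(characterM chiA) rmult_lmult.
have [c c1] := character_eq1 chiA.
have := E c a; have := E c b; rewrite c1 !mul1r => -> ->.
by rewrite mulrAC.
Qed.

Lemma lmult_continuous a : continuous (fun m => lmult m a).
Proof.
apply: (@rnorm_lipschitz_continuous _ _ _ _ (rnorm a)) => m m'.
have -> : lmult m a - lmult m' a = lmult (m - m') a by rewrite /= scaleN1r.
rewrite -lecR rmorphM /= !rnormE mulrC; exact: ler_multiplier_norm.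
Qed.

Lemma exists_char_ext :
  exists f, Sp (multiplier A) f /\ forall a, f (to_multiplier a) = chi a.
Proof.
have [c c1] := character_eq1 chiA.
have to a : chi (lmult (to_multiplier a) c) = chi a.
  by rewrite /= (characterM chiA) c1 mulr1.
exists (fun m => chi (lmult m c)); split=> //; split.
- move=> k m m' /=; rewrite (scalar_mapD (character_linear chiA)).
  by rewrite (scalar_mapZ (character_linear chiA)).
- by move=> m m'; have := lmult_char m (lmult m' c) c; rewrite c1 mulr1.
- move=> m; apply: continuous_comp; first exact: lmult_continuous.
  exact: character_continuous chiA _.
- by exists (to_multiplier c); rewrite to c1 oner_neq0.
Qed.

Lemma char_extE m a : char_ext chi m * chi a = chi (lmult m a).
Proof.
have [[_ fM _ _] fE] := xgetPex (fun=> 0) exists_char_ext.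
rewrite -/(char_ext chi) in fM fE.
by rewrite -fE -fM multiplier_mul_to fE.
Qed.

End extension.

(** * Minima in good semilattices *)

Section semilattice_minimum.
Context {d : Order.disp_t} {L : meetSemilatticeType d}.

(** Without a minimum, every element of [S] could be met with another one to get
    a strictly smaller element; iterating gives a descending chain without
    a least element. *)
Lemma good_minimum (S : set L) : good_semilattice L -> S !=set0 ->
  meet_stable S -> exists2 m, S m & forall j, S j -> (m <= j)%O.
Proof.
move=> L_good [j0 Sj0] SM; apply: contrapT => nomin.
have /choice[f fP] : forall j, exists k, S j -> S k /\ (k < j)%O.
  move=> j; have [Sj|//] := pselect (S j); last by exists j.
  have [k [Sk jk]] : exists k, S k /\ ~~ (j <= k)%O.
    apply: contrapT => nok; apply: nomin; exists j => // k Sk.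
    by apply: contrapT => /negP jk; apply: nok; exists k.
  exists (j `&` k)%O => _; split; first exact: SM.
  by rewrite lt_neqAle leIl andbT; apply: contra jk => /eqP <-; exact: leIr.
have uS n : S (iter n f j0) by elim: n => //= n /fP[].
have u_lt n : (iter n.+1 f j0 < iter n f j0)%O by have [] := fP _ (uS n).
have u_le m n : (m <= n)%N -> (iter n f j0 <= iter m f j0)%O.
  elim: n => [|n IH]; first by rewrite leqn0 => /eqP ->.
  rewrite leq_eqVlt => /predU1P[->//|/IH]; exact: le_trans (ltW (u_lt n)).
pose C := range (fun n => iter n f j0).
have C0 : C !=set0 by exists j0, 0%N.
have Ctot : totally_ordered C.
  move=> _ _ [m _ <-] [n _ <-]; rewrite /Order.comparable.
  by case/orP: (leq_total m n) => /u_le ->; rewrite ?orbT.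
have [_ [n _ <-] nmin] := L_good _ C0 Ctot C (fun _ => id) C0.
have /nmin : C (iter n.+1 f j0) by exists n.+1.
by rewrite lt_geF.
Qed.

End semilattice_minimum.

(** * The spectrum of a commutative graded algebra *)

Section spectrum.
Context {R : realType} {d : Order.disp_t} {L : meetSemilatticeType d}.
Context {A : cstarType R} {A_ : L -> subCStar A}.
Variable gA : graded A_.
Hypothesis AC : commutative (@amul _ A).

Lemma cval_continuous (B : subCStar A) : continuous (@cval _ _ B).
Proof.
by apply: (@rnorm_lipschitz_continuous _ _ _ _ 1) => x y; rewrite mul1r.
Qed.

Lemma psiE i (chi : A_ i -> R[i]) x (a : A_ i) : Sp (A_ i) chi ->
  psi gA i chi x * chi a = chi (lmult (phi gA i (Defs.proj gA i x)) a).
Proof. by move=> /char_extE; apply. Qed.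

Lemma phi_continuous i (a : A_ i) :
  continuous (fun b : above gA i => lmult (phi gA i b) a).
Proof.
apply: (@rnorm_lipschitz_continuous _ _ _ _ (rnorm a)) => b b'.
rewrite mulrC; apply: le_trans (rnormM (cval b - cval b') (cval a)).
by rewrite amulBl.
Qed.

Lemma psi_character i (chi : A_ i -> R[i]) :
  Sp (A_ i) chi -> Sp A (psi gA i chi).
Proof.
move=> chiA; have [c c1] := character_eq1 chiA.
have [[pl pM _ pc] pid _] := projP gA AC i.
have psi1 x : psi gA i chi x = chi (lmult (phi gA i (Defs.proj gA i x)) c).
  by rewrite -[LHS]mulr1 -c1 psiE.
split.
- move=> k x y; rewrite !psi1 pl -(scalar_mapZ (character_linear chiA)).
  rewrite -(scalar_mapD (character_linear chiA)); congr chi.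
  by apply: val_inj => /=; rewrite amulDl scale_amull.
- move=> x y; rewrite [psi _ _ _ y]psi1 psiE// psi1 pM; congr chi.
  by apply: val_inj => /=; rewrite amulA.
- rewrite (funext psi1) => x.
  apply: (@continuous_comp A (above gA i) R[i]^o (Defs.proj gA i)
    (fun b => chi (lmult (phi gA i b) c))); first exact: pc.
  apply: (@continuous_comp (above gA i) (A_ i) R[i]^o
    (fun b => lmult (phi gA i b) c) chi); first exact: phi_continuous.
  exact: character_continuous chiA _.
- exists (cval c); rewrite psi1 (_ : lmult _ _ = c ** c).
    by rewrite (characterM chiA) c1 mulr1 oner_neq0.
  by apply: val_inj => /=; rewrite (pid i)//; exact: cval_set.
Qed.

Lemma continuous_components_eq (f g : A -> R[i]) :
  scalar f -> scalar g ->
  continuous (f : A -> R[i]^o) -> continuous (g : A -> R[i]^o) ->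
  (forall j x, subCStar_set (A_ j) x -> f x = g x) -> f =1 g.
Proof.
move=> fl gl fc gc fg x; apply/eqP; rewrite -subr_eq0; apply/eqP.
pose h y : R[i]^o := f y - g y.
have hc : continuous h by move=> y; apply: cvgB; [exact: fc|exact: gc].
have c0 : closed [set 0 : R[i]^o].
  exact/accessible_closed_set1/hausdorff_accessible/norm_hausdorff.
have /closed_rnorm : closed (h @^-1` [set 0]).
  by move/continuous_closedP : hc; apply.
apply=> e e0; have [y Dy xy] := dense_rnorm x (graded_total gA) e0.
exists y => //; apply/eqP; rewrite subr_eq0; apply/eqP.
move: y Dy {xy}; apply: cspan_ind => [|y z fgy fgz|k y [j _ jy]].
- by rewrite (scalar_map0 fl) (scalar_map0 gl).
- by rewrite (scalar_mapD fl) (scalar_mapD gl) fgy fgz.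
- by rewrite (scalar_mapZ fl) (scalar_mapZ gl) (fg j).
Qed.

Lemma restriction_character i (chi : A -> R[i]) (a : A_ i) : Sp A chi ->
  chi (cval a) != 0 -> Sp (A_ i) (fun b => chi (cval b)).
Proof.
move=> chiA a0; split.
- move=> k x y /=; rewrite (scalar_mapD (character_linear chiA)).
  by rewrite (scalar_mapZ (character_linear chiA)).
- by move=> x y /=; rewrite (characterM chiA).
- move=> x; apply: (@continuous_comp (A_ i) A R[i]^o
    (@cval _ _ (A_ i)) chi).
    exact: cval_continuous.
  exact: character_continuous chiA _.
- by exists a.
Qed.

Definition char_support (chi : A -> R[i]) : set L :=
  [set j | exists2 a, subCStar_set (A_ j) a & chi a != 0].

(** A character vanishing on all components would vanish, by totality. *)
Lemma char_support_neq0 chi : Sp A chi -> char_support chi !=set0.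
Proof.
move=> chiA; apply: contrapT => supp0.
have [a /eqP] := character_neq0 chiA; apply.
have zl : scalar (fun _ : A => 0 : R[i]).
  by move=> k x y; rewrite mulr0 addr0.
apply: (continuous_components_eq (character_linear chiA) zl).
- exact: character_continuous chiA.
- by move=> x; exact: cvg_cst.
move=> j x jx; apply/eqP; apply: contrapT => /negP x0.
by apply: supp0; exists j, x.
Qed.

Lemma char_support_meet chi : Sp A chi -> meet_stable (char_support chi).
Proof.
move=> chiA j k [a ja a0] [b kb b0]; exists (a ** b); first exact: gradedM.
by rewrite (characterM chiA) mulf_neq0.
Qed.

(** The claim amounts to the invariance of [chi] under the projection, which may
    be checked on the components.  On [A_ j] with [j] above [i] the projection
    is the identity; on the others it vanishes, and so does [chi] by the choice
    of [i]. *)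
Lemma psi_restriction i (chi : A -> R[i]) : Sp A chi -> char_support chi i ->
  (forall j, char_support chi j -> (i <= j)%O) ->
  psi gA i (fun b => chi (cval b)) = chi.
Proof.
move=> chiA [a ia a0] imin.
have chi_i := @restriction_character i _ (SubCStarElt (asboolT ia)) chiA a0.
have [[pl pM _ pc] pid p0] := projP gA AC i.
apply/funext => x; apply: (mulIf a0).
have := psiE x (SubCStarElt (asboolT ia)) chi_i; rewrite /= => ->.
rewrite (characterM chiA); congr (_ * _).
move: x; apply: continuous_components_eq.
- move=> k x y; rewrite pl /= (scalar_mapD (character_linear chiA)).
  by rewrite (scalar_mapZ (character_linear chiA)).
- exact: character_linear chiA.
- move=> x; apply: (@continuous_comp A (above gA i) R[i]^o
    (Defs.proj gA i) (fun b => chi (cval b))).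
    exact: pc.
  apply: (@continuous_comp (above gA i) A R[i]^o
    (@cval _ _ (above gA i)) chi); first exact: cval_continuous.
  exact: character_continuous chiA _.
- exact: character_continuous chiA.
move=> j x jx; have [ij|ij] := boolP (i <= j)%O; first by rewrite (pid j).
rewrite (p0 j)//= (scalar_map0 (character_linear chiA)).
apply/esym/eqP; apply: contrapT => /negP x0.
by move/negP: ij; apply; apply: imin; exists x.
Qed.

End spectrum.

Theorem proposition5p1p3 (R : realType) (d : Order.disp_t)
    (L : meetSemilatticeType d) (A : cstarType R) (A_ : L -> subCStar A)
    (gA : graded A_) (A_comm : commutative (@amul _ A))
    (L_good : good_semilattice L) :
  Sp A = \bigcup_(i in [set: L]) (psi gA i @` Sp (A_ i)).
Proof.
apply/seteqP; split=> [chi chiA|_ [i _ [chi chiA <-]]]; last first.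
  exact: psi_character.
have [i ichi imin] := good_minimum L_good (char_support_neq0 gA chiA)
  (char_support_meet gA chiA).
exists i => //; exists (fun b => chi (cval b)); last exact: psi_restriction.
case: ichi => a ia a0.
exact: (@restriction_character _ _ _ _ _ _ _ (SubCStarElt (asboolT ia))
  chiA a0).
Qed.
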